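(* Let $n\ge2$ be an integer, $\alpha=n+2$, and let $t,q$ be real numbers with $\frac n{n+2}<t<1$ and $\frac{n-1}{n+1}<q<1$. Let $t'$ be defined by $\frac1t+\frac1{t'}=1$ and set $\widetilde\gamma:=\frac{(n-1)-q(\alpha-1)-\frac{n}{t'}q}{(n-1)(1-q)}$. Then the extremal functions for the inequality $$\|\widetilde E_\alpha f\|_{L^{t'}(\mathbb R^n_+)}\ \ge\ \widetilde{\mathscr C}(n,\alpha,q,t)\,\|f\|_{L^1(\partial\mathbb R^n_+)}^{\widetilde\gamma}\|f\|_{L^q(\partial\mathbb R^n_+)}^{1-\widetilde\gamma},\qquad 0\le f\in L^1(\partial\mathbb R^n_+)\cap L^q(\partial\mathbb R^n_+),\ f\not\equiv0,$$ with sharp constant $\widetilde{\mathscr C}(n,\alpha,q,t)$, are given, up to translations (on $\partial\mathbb R^n_+$), dilations and (positive) constant multiples, by $$f(x)=\left(1+|x|^2\right)^{-\frac1{1-q}},\qquad x\in\partial\mathbb R^n_+.$$ Moreover, the sharp constant is $$\widetilde{\mathscr C}(n,n+2,q,t)=\frac1\pi\left[\left(\frac{q(n+1)-n+1}{2q}\right)^{\frac{n+2t'}{(n-1)(1-q)}}\left(\frac{(n-1)(1-q)}{q(n+1)-n+1}\right)^{\frac n2+t'}\left(\frac{\Gamma\left(\frac1{1-q}\right)}{\Gamma\left(\frac1{1-q}-\frac{n-1}2\right)}\right)^{\frac{n+2t'}{n-1}}\frac{\Gamma\left(-t'-\frac n2\right)}{2\,\Gamma(-t')}\right]^{\frac1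{t'}}.$$
   Context: $\mathbb R^n_+:=\{x=(x',x_n)\in\mathbb R^n:x_n>0\}$, and $\partial\mathbb R^n_+=\{x_n=0\}$ is identified with $\mathbb R^{n-1}$ with Lebesgue measure. For a nonnegative measurable $f$ on $\partial\mathbb R^n_+$, $\widetilde E_\alpha f(x):=\int_{\partial\mathbb R^n_+}|x-y|^{\alpha-n}f(y)\,dy\in[0,\infty]$ for $x=(x',x_n)\in\mathbb R^n_+$, where $|x-y|=(|x'-y|^2+x_n^2)^{1/2}$. For $\Omega=\mathbb R^n_+$ or $\partial\mathbb R^n_+$ and real $p\ne0$, $f\in L^p(\Omega)$ means $\int_\Omega|f|^p<\infty$, and $\|f\|_{L^p(\Omega)}:=\left(\int_\Omega|f|^p\right)^{1/p}$ (only a quasi-norm for $0<p<1$). Note that $0<t<1$ gives $t'<0$; for negative exponents the usual conventions $0^{t'}=\infty$, $\infty^{t'}=0$, $0^{1/t'}=\infty$, $\infty^{1/t'}=0$ are used. The sharp constant is $\widetilde{\mathscr C}(n,\alpha,q,t):=\inf\left\{\frac{\|\widetilde E_\alpha f\|_{L^{t'}(\mathbb R^n_+)}}{\|f\|_{L^1(\partial\mathbb R^n_+)}^{\widetilde\gamma}\|f\|_{L^q(\partial\mathbb R^n_+)}^{1-\widetilde\gamma}}:0\le f\in L^1(\partial\mathbb R^n_+)\cap L^q(\partial\mathbb R^n_+),\ f\not\equiv0\right\}$, and an extremal function is an $f$ in this class attaining the infimum. $\Gamma$ is the Gamma function. *)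

(* Defs.v *)
From HB Require Import structures.
From mathcomp Require Import all_boot all_order all_algebra.
From mathcomp Require Import all_classical all_reals all_analysis.

Set Implicit Arguments.
Unset Strict Implicit.
Unset Printing Implicit Defensive.

Import Order.TTheory GRing.Theory Num.Theory.
Import numFieldNormedType.Exports.

Local Open Scope classical_set_scope.
Local Open Scope ring_scope.

(* R^m, as m-tuples with the product (= Borel) sigma-algebra. *)
Notation Rn R m := (m.-tuple (measurableTypeR R)).

Section lebesgue_measure_Rn.
Variable R : realType.

Definition consRn m (p : measurableTypeR R * Rn R m) : Rn R m.+1 :=
  [the m.+1.-tuple (measurableTypeR R) of p.1 :: p.2].

Lemma measurable_consRn m : measurable_fun [set: _] (@consRn m).
Proof. exact: measurable_cons. Qed.

Section step.
Variables (m : nat) (mu : {sigma_finite_measure set (Rn R m) -> \bar R}).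

Definition lebesgue_step : set (Rn R m.+1) -> \bar R :=
  pushforward (@lebesgue_measure R \x mu)%E (@consRn m).

Let pushed : {measure set (Rn R m.+1) -> \bar R} :=
  measure_function_pushforward__canonical__measure_function_Measure
    (@lebesgue_measure R \x mu)%E (@measurable_consRn m).

HB.instance Definition _ := isMeasure.Build _ _ _ lebesgue_step
  (measure0 pushed) (measure_ge0 pushed) (@measure_semi_sigma_additive _ _ _ pushed).

Lemma lebesgue_step_sigma_finite : sigma_finite setT lebesgue_step.
Proof.
have /sigma_finiteP[F [FT ndF Foo]] := sigma_finiteT (@lebesgue_measure R).
have /sigma_finiteP[G [GT ndG Goo]] := sigma_finiteT mu.
pose u (x : Rn R m.+1) : measurableTypeR R * Rn R m :=
  (thead x, [tuple of behead x]).
have mu_ : measurable_fun setT u.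
  apply/measurable_fun_pairP; split; first exact: measurable_tnth.
  exact: measurable_behead.
have uK p : u (consRn p) = p.
  by case: p => a b; congr pair; exact/val_inj.
exists (fun k => u @^-1` (F k `*` G k)).
  apply/seteqP; split=> // x _.
  have [i _ Fi] : (\bigcup_i F i) (u x).1 by rewrite -FT.
  have [j _ Gj] : (\bigcup_j G j) (u x).2 by rewrite -GT.
  exists (maxn i j) => //; split.
  - exact: (subsetPset _ _ (ndF _ _ (leq_maxl i j))).
  - exact: (subsetPset _ _ (ndG _ _ (leq_maxr i j))).
move=> k; have [mF Fk] := Foo k; have [mG Gk] := Goo k; split.
  by rewrite -[X in measurable X]setTI; apply: mu_ => //; exact: measurableX.
rewrite /lebesgue_step /pushforward -comp_preimage.
rewrite (_ : u \o _ = id); last by apply/funext => p /=; rewrite uK.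
rewrite preimage_id [ltLHS]product_measure1E//.
by rewrite lte_mul_pinfty// ge0_fin_numE.
Qed.

HB.instance Definition _ :=
  Measure_isSigmaFinite.Build _ _ _ lebesgue_step lebesgue_step_sigma_finite.

End step.

(* Lebesgue measure on R^m: the m-fold product of the one-dimensional one. *)
Fixpoint lebesgue_Rn m : {sigma_finite_measure set (Rn R m) -> \bar R} :=
  match m with
  | 0 => [the {sigma_finite_measure set _ -> \bar R} of
            dirac ([tuple] : Rn R 0)]
  | m'.+1 => [the {sigma_finite_measure set _ -> \bar R} of
                lebesgue_step (lebesgue_Rn m')]
  end.

Lemma lebesgue_Rn_box m (A : 'I_m -> set (measurableTypeR R)) :
  (forall i, measurable (A i)) ->
  lebesgue_Rn m [set x | forall i, A i (tnth x i)] =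
  (\prod_(i < m) lebesgue_measure (A i))%E.
Proof.
elim: m A => [|m IH] A mA /=.
  rewrite big_ord0 diracE mem_set//= => -[] //.
rewrite big_ord_recl -IH// -product_measure1E//; last first.
  rewrite (_ : mkset _ = \bigcap_(i in [set: 'I_m])
      ((fun x : Rn R m => tnth x i) @^-1` A (lift ord0 i))).
    apply: fin_bigcap_measurable => // i _.
    by rewrite -[X in measurable X]setTI; exact: measurable_tnth.
  by apply/seteqP; split => x /= h i; [move=> _|]; exact: h.
rewrite /lebesgue_step /pushforward; congr (product_measure1 _ _ _).
apply/seteqP; split => -[a b] /= h.
  split; first exact: (h ord0).
  by move=> i; have := h (lift ord0 i); rewrite tnthS.
by case: h => ha hb i; case: (unliftP ord0 i) => [j|] ->//; rewrite tnthS.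
Qed.

End lebesgue_measure_Rn.

Section norms.
Context {R : realType}.
Local Open Scope ereal_scope.

(* Unlike poweR, this satisfies 0^r = +oo and (+oo)^r = 0 for r < 0
   (recall 0^-1 = +oo and +oo^-1 = 0 in \bar R). *)
Definition epow (x : \bar R) (r : R) : \bar R :=
  if (0 <= r)%R then x `^ r else (x `^ (- r))^-1.

Context {d : measure_display} {T : measurableType d}.
Variable mu : {measure set T -> \bar R}.

Definition int_pow (D : set T) (p : R) (f : T -> \bar R) : \bar R :=
  \int[mu]_(x in D) epow `|f x| p.

Definition lp_norm (D : set T) (p : R) (f : T -> \bar R) : \bar R :=
  epow (int_pow D p f) p^-1.

End norms.

Definition Gamma {R : realType} (a : R) : R :=
  \int[@lebesgue_measure R]_(s in `]0, +oo[) (s `^ (a - 1) * expR (- s)).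

Section extension_operator.
Variable R : realType.
Variable n : nat.

(* R^n is written R^(n-1) x R, with points x = (x', x_n). *)
Definition half_space : set (Rn R n.-1 * measurableTypeR R) := [set x | 0 < x.2].

Definition lebesgue_space : {measure set (Rn R n.-1 * measurableTypeR R)%type -> \bar R} :=
  (lebesgue_Rn R n.-1 \x @lebesgue_measure R)%E.

(* |x - y| for y in R^(n-1), identified with (y, 0). *)
Definition dist_boundary (x : Rn R n.-1 * measurableTypeR R) (y : Rn R n.-1) : R :=
  Num.sqrt (\sum_(i < n.-1) (tnth x.1 i - tnth y i) ^+ 2 + x.2 ^+ 2).

Definition extension (alpha : R) (f : Rn R n.-1 -> R)
    (x : Rn R n.-1 * measurableTypeR R) : \bar R :=
  (\int[lebesgue_Rn R n.-1]_y (dist_boundary x y `^ (alpha - n%:R) * f y)%:E)%E.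

Definition norm_boundary (p : R) (f : Rn R n.-1 -> R) : \bar R :=
  lp_norm (lebesgue_Rn R n.-1) setT p (EFin \o f).

Definition norm_half_space (p : R) (F : Rn R n.-1 * measurableTypeR R -> \bar R) : \bar R :=
  lp_norm lebesgue_space half_space p F.

Definition in_Lp_boundary (p : R) (f : Rn R n.-1 -> R) : Prop :=
  measurable_fun setT f /\
  (int_pow (lebesgue_Rn R n.-1) setT p (EFin \o f) < +oo)%E.

Definition conj_exponent (t : R) : R := (1 - t^-1)^-1.

Definition gamma_tilde (alpha q t : R) : R :=
  ((n%:R - 1) - q * (alpha - 1) - n%:R / conj_exponent t * q) /
  ((n%:R - 1) * (1 - q)).

(* f <> 0 is understood in L^1, i.e. modulo null sets. *)
Definition admissible (q : R) (f : Rn R n.-1 -> R) : Prop :=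
  [/\ forall x, 0 <= f x, in_Lp_boundary 1 f, in_Lp_boundary q f &
      ~ {ae lebesgue_Rn R n.-1, forall x, f x = 0}].

Definition rhs_norms (alpha q t : R) (f : Rn R n.-1 -> R) : \bar R :=
  (epow (norm_boundary 1 f) (gamma_tilde alpha q t) *
   epow (norm_boundary q f) (1 - gamma_tilde alpha q t))%E.

Definition quotient (alpha q t : R) (f : Rn R n.-1 -> R) : \bar R :=
  (norm_half_space (conj_exponent t) (extension alpha f) /
   rhs_norms alpha q t f)%E.

Definition sharp_const (alpha q t : R) : \bar R :=
  ereal_inf [set quotient alpha q t f | f in admissible q].

Definition extremal (alpha q t : R) (f : Rn R n.-1 -> R) : Prop :=
  admissible q f /\ quotient alpha q t f = sharp_const alpha q t.

Definition bubble (q : R) (x : Rn R n.-1) : R :=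
  (1 + \sum_(i < n.-1) (tnth x i) ^+ 2) `^ (- (1 - q)^-1).

Definition translate_dilate (l : R) (x0 x : Rn R n.-1) : Rn R n.-1 :=
  [tuple l * (tnth x i - tnth x0 i) | i < n.-1].

End extension_operator.

(* Main.v *)
Require Import Defs.
From HB Require Import structures.
From mathcomp Require Import all_boot all_order all_algebra.
From mathcomp Require Import ring lra.
From mathcomp Require Import all_classical all_reals all_analysis.
From mathcomp Require Import measurable_realfun.

Set Implicit Arguments.
Unset Strict Implicit.
Unset Printing Implicit Defensive.

Import Order.TTheory GRing.Theory Num.Theory.
Import numFieldNormedType.Exports.

Local Open Scope classical_set_scope.
Local Open Scope ring_scope.

(** A function [f] with finite second moment has extension
    [M (|x'-b|^2 + x_n^2) + V], where [M] is its mass, [b] its barycenter and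
    [V] its centered second moment; otherwise the extension is [+oo] on the half
    space and the quotient is [+oo].  The numerator is thus an explicit function
    of [M] and [V], and the quotient is smallest when [int f^q] is largest for
    given [M] and [V].  Integrating the concavity inequality
    [a^q <= q w^(q-1) a + (1-q) w^q] against the bubble [w] centered at [b] with
    the same [M] and [V] works because [w^(q-1)] is affine in [|y-b|^2]: it gives
    [int f^q <= int w^q], with equality only for [f = w].  The constant then comes
    from [int (A + B|y-b|^2)^(-s)], computed by writing the power as a Gamma
    integral of Gaussians. *)

(** * Gamma integrals on the half line *)

Section scaling.
Variable R : realType.
Notation mu := (@lebesgue_measure R).
Local Open Scope ereal_scope.

(** Multiples and dilations of [f] leave the quotient unchanged; for dilations this is what fixes
    the exponent [gamma_tilde]. They form a two-parameter family, which reaches every pair [(M, V)]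
    from a single bubble, so the optimal value is the same for all [M] and [V] and one algebraic
    identity yields the constant. The hypotheses on [t] and [q] are convergence conditions in
    disguise. The bound on [t] says [n / 2 < - t']: the power [t'] of a quadratic is integrable on
    the half space, and also [1 - gamma_tilde > 0], which is why a larger integral of [f^q] lowers
    the quotient. The bound on [q] says [(n - 1) / 2 < (1 - q)^-1 - 1]: the integral of [w^q] and
    the second moment of [w] converge. Both rational bases in the constant come from one ratio
    [rho], the integral of [(1 + L|y-b|^2)^(1-s)] over that of [(1 + L|y-b|^2)^(-s)] with
    [s = (1 - q)^-1]: they are [rho^-1] and [rho - 1 = L V / M]. *)

Lemma ge0_integral_scale (c : R) (f : R -> \bar R) : (0 < c)%R ->
  measurable_fun [set: R] f -> (forall x, 0 <= f x) ->
  \int[mu]_(x in `]0%R, +oo[) f (c * x)%R =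
  c^-1%:E * \int[mu]_(x in `]0%R, +oo[) f x.
Proof.
move=> c0 mf f0.
have mc : measurable_fun [set: measurableTypeR R] ( *%R c : _ -> measurableTypeR R).
  exact: measurable_funM.
have c1 : (0 <= c^-1)%R by rewrite invr_ge0 ltW.
(* The pushforward under multiplication by [c], rescaled by [c], agrees with Lebesgue measure on
   half-open intervals, so the two coincide by uniqueness. *)
have muE A : measurable A ->
    pushforward mu ( *%R c : _ -> measurableTypeR R) A = mscale (NngNum c1) mu A.
  move=> mA.
  pose nu := mscale (NngNum (ltW c0))
    (measure_function_pushforward__canonical__measure_function_Measure mu mc).
  have muA : mu A = nu A.
    apply: lebesgue_measure_unique => //= _ [[a b]] _ <-.
    rewrite /nu /mscale/= /pushforward.
    have -> : *%R c @^-1` `]a, b] = `](a / c)%R, (b / c)%R]%classic.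
      by apply/seteqP; split => x /=; rewrite !in_itv/= ltr_pdivrMr// ler_pdivlMr// [(x * c)%R]mulrC.
    rewrite !lebesgue_measure_itv/= !lte_fin ltr_pM2r ?invr_gt0//.
    case: ifPn => _; last by rewrite mule0.
    by rewrite -EFinB -EFinM -mulrBl mulrC divfK ?gt_eqF.
  by rewrite [RHS]/mscale/= muA /nu /mscale/= muleA -EFinM mulVf ?gt_eqF// mul1e.
have preim0 : *%R c @^-1` `]0%R, +oo[%classic = `]0%R, +oo[%classic.
  by apply/seteqP; split => x /=; rewrite !in_itv/= !andbT pmulr_rgt0.
have mf' : measurable_fun (`]0%R, +oo[%classic : set R) f by exact: measurable_funS mf.
transitivity (\int[pushforward mu ( *%R c : _ -> measurableTypeR R)]_(x in `]0%R, +oo[) f x).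
  by rewrite (ge0_integral_pushforward mc)// preim0.
rewrite (eq_measure_integral (mscale (NngNum c1) mu)); last by move=> A mA _; exact: muE.
by rewrite ge0_integral_mscale.
Qed.

End scaling.

Lemma gt0_powRD (R : realType) (x r s : R) : 0 < x -> x `^ (r + s) = x `^ r * x `^ s.
Proof. by move=> x0; rewrite powRD//; apply/implyP => _; rewrite gt_eqF. Qed.

Section fubini_restrict.
Local Open Scope ereal_scope.

Lemma fubini_tonelli_restrict d1 d2 (T1 : measurableType d1) (T2 : measurableType d2)
    (R : realType) (m1 : {sigma_finite_measure set T1 -> \bar R})
    (m2 : {sigma_finite_measure set T2 -> \bar R})
    (D1 : set T1) (D2 : set T2) (f : T1 * T2 -> \bar R) :
  measurable D1 -> measurable D2 -> measurable_fun setT f -> (forall z, 0 <= f z) ->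
  \int[m1]_(x in D1) \int[m2]_(y in D2) f (x, y) =
  \int[m2]_(y in D2) \int[m1]_(x in D1) f (x, y).
Proof.
move=> mD1 mD2 mf f0; pose g := f \_ (D1 `*` D2).
have g0 z : 0 <= g z by apply: erestrict_ge0.
have mg : measurable_fun setT g.
  apply/(measurable_restrictT _ _).1; first exact: measurableX.
  exact: measurable_funS mf.
have := fubini_tonelli (m1 := m1) (m2 := m2) g mg g0.
have gx x : \int[m2]_y g (x, y) = ((fun x => \int[m2]_(y in D2) f (x, y)) \_ D1) x.
  rewrite patchE; case: ifPn => xD.
    rewrite [RHS]integral_mkcond; apply: eq_integral => y _.
    by rewrite /g !patchE in_setX xD.
  by rewrite integral0_eq// => y _; rewrite /g patchE in_setX (negbTE xD).
have gy y : \int[m1]_x g (x, y) = ((fun y => \int[m1]_(x in D1) f (x, y)) \_ D2) y.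
  rewrite patchE; case: ifPn => yD.
    rewrite [RHS]integral_mkcond; apply: eq_integral => x _.
    by rewrite /g !patchE in_setX yD andbT.
  by rewrite integral0_eq// => x _; rewrite /g patchE in_setX (negbTE yD) andbF.
under eq_integral do rewrite gx.
under [RHS]eq_integral do rewrite gy.
by rewrite -!integral_mkcond.
Qed.

End fubini_restrict.

Section Gamma.
Variable R : realType.
Notation mu := (@lebesgue_measure R).
Local Open Scope ereal_scope.

(** [Gamma] is a real integral, which would turn an infinite value into 0. The extended version lets
    Tonelli and scaling be applied before finiteness is known; [eGammaE] identifies the two for
    [a > 0]. *)
Definition eGamma (a : R) : \bar R :=
  \int[mu]_(s in `]0%R, +oo[) (s `^ (a - 1) * expR (- s))%:E.

Lemma eGamma_ge0 a : 0 <= eGamma a.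
Proof. by apply: integral_ge0 => x _; rewrite lee_fin mulr_ge0 ?powR_ge0 ?expR_ge0. Qed.

Lemma measurable_powR_exp (s A : R) :
  measurable_fun [set: R] (fun x : R => (x `^ s * expR (- (A * x)))%:E).
Proof.
apply/measurable_EFinP/measurable_funM; first exact: measurable_powR.
apply: measurableT_comp; first exact: measurable_expR.
by apply: measurableT_comp => //; exact: measurable_funM.
Qed.

(** Substituting [A x] for [x]. It holds for every real [s], infinite values included, so it can
    serve in the functional equation that finiteness itself depends on. *)
Lemma integral_powR_exp (s A : R) : (0 < A)%R ->
  \int[mu]_(x in `]0%R, +oo[) (x `^ (s - 1) * expR (- (A * x)))%:E =
  (A `^ (- s))%:E * eGamma s.
Proof.
move=> A0.
have sc := @ge0_integral_scale R A (fun x : R => (x `^ (s - 1) * expR (- (1 * x)))%:E) A0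
  (measurable_powR_exp _ _) (fun x => mulr_ge0 (powR_ge0 _ _) (expR_ge0 _)).
have eG : eGamma s = \int[mu]_(x in `]0%R, +oo[) (x `^ (s - 1) * expR (- (1 * x)))%:E.
  by apply: eq_integral => x _; rewrite mul1r.
rewrite -eG in sc.
have : (A `^ (s - 1))%:E * \int[mu]_(x in `]0%R, +oo[) (x `^ (s - 1) * expR (- (A * x)))%:E
   = A^-1%:E * eGamma s.
  rewrite -sc -ge0_integralZl//=; last 3 first.
  - exact: measurable_funTS (measurable_powR_exp _ _).
  - by move=> x _; rewrite lee_fin mulr_ge0 ?powR_ge0 ?expR_ge0.
  - by rewrite lee_fin powR_ge0.
  apply: eq_integral => x; rewrite inE/= in_itv/= andbT => x0.
  by rewrite -EFinM mul1r powRM ?ltW// mulrA.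
move=> /(congr1 (fun z => (A `^ (1 - s))%:E * z)).
rewrite !muleA -!EFinM -gt0_powRD//.
rewrite (_ : 1 - s + (s - 1) = 0)%R ?powRr0 ?mul1e; last by ring.
rewrite -(powR_inv1 (ltW A0)) -gt0_powRD//.
by rewrite (_ : 1 - s + -1 = - s)%R; last by ring.
Qed.

Lemma ge0_is_derive_FTC2y (f F : R -> R) (a l : R) :
  (forall x, (a <= x)%R -> (0 <= f x)%R) ->
  (forall x, (a <= x)%R -> {for x, continuous f}) ->
  (forall x, (a <= x)%R -> is_derive x (1%R : R) F (f x)) ->
  F x @[x --> +oo%R] --> l ->
  \int[mu]_(x in `[a, +oo[) (f x)%:E = (l - F a)%:E.
Proof.
move=> f0 cf dF Fl.
have dF1 x : (a <= x)%R -> derivable F x 1%R by move=> /dF [].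
rewrite (@ge0_continuous_FTC2y _ f F a l)//.
- apply/continuous_within_itvcyP; split.
    by move=> x; rewrite in_itv/= andbT => /ltW; exact: cf.
  by apply: cvg_at_right_filter; exact: cf.
- by move=> x /ltW; exact: dF1.
- apply: cvg_at_right_filter; apply: differentiable_continuous.
  by apply/derivable1_diffP; exact: dF1.
- by move=> x; rewrite in_itv/= andbT => /ltW /dF [_ <-]; rewrite derive1E.
Qed.

Lemma ln_pinfty : @ln R x @[x --> +oo%R] --> +oo%R.
Proof.
apply/cvgryPge => B; near=> x.
have x0 : (0 < x)%R by near: x; exact: nbhs_pinfty_gt.
by rewrite -ler_expR lnK//; near: x; exact: nbhs_pinfty_ge.
Unshelve. all: by end_near. Qed.

Lemma powRN_pinfty (a : R) : (0 < a)%R -> (x `^ (- a))%R @[x --> +oo%R] --> (0 : R)%R.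
Proof.
move=> a0.
have : expR (- (a * ln x)) @[x --> +oo%R] --> (0 : R)%R.
  apply: (@cvg_comp _ _ _ (fun x => a * ln x)%R (fun z => expR (- z)) _ (pinfty_nbhs R)).
    by apply: gt0_cvgMry => //; exact: ln_pinfty.
  exact: cvgr_expR.
apply: cvg_trans; apply: near_eq_cvg; near=> x.
by rewrite /powR gt_eqF ?mulNr.
Unshelve. all: by end_near. Qed.

Lemma integral_powR_tail (a : R) : (0 < a)%R ->
  \int[mu]_(v in `[1%R, +oo[) (v `^ (- a - 1))%:E = a^-1%:E.
Proof.
move=> a0.
have pos x : (1 <= x)%R -> (0 < x)%R by apply: lt_le_trans.
transitivity (0 - - (a^-1 * 1 `^ (- a)))%:E; last by rewrite powR1 mulr1 sub0r opprK.
apply: (@ge0_is_derive_FTC2y _ (fun x => - (a^-1 * x `^ (- a)))%R).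
- by move=> x _; exact: powR_ge0.
- move=> x /pos x0; apply: differentiable_continuous; apply/derivable1_diffP.
  by apply: derivable_powR; rewrite in_itv/= x0.
- move=> x /pos x0.
  have dx := is_derive1_powR (- a) x0.
  apply: is_derive_eq.
  by rewrite /GRing.scale/=; field; rewrite gt_eqF.
- suff : (- (a^-1 * x `^ (- a)))%R @[x --> +oo%R] --> (- (a^-1 * 0))%R by rewrite mulr0 oppr0.
  apply: cvgN; apply: cvgMl_tmp.
  exact: powRN_pinfty.
Qed.

Lemma integral_exp_tail (s : R) : (0 < s)%R ->
  \int[mu]_(v in `[1%R, +oo[) (expR (- (s * v)))%:E = (expR (- s) / s)%:E.
Proof.
move=> s0.
transitivity (0 - - (s^-1 * expR (- (s * 1))))%:E; last by rewrite mulr1 sub0r opprK mulrC.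
apply: (@ge0_is_derive_FTC2y _ (fun x => - (s^-1 * expR (- (s * x))))%R).
- by move=> x _; exact: expR_ge0.
- move=> x _; apply: differentiable_continuous; apply/derivable1_diffP.
  exact: ex_derive.
- move=> x _.
  apply: is_derive_eq.
  by rewrite /GRing.scale/=; field; rewrite gt_eqF.
- suff : (- (s^-1 * expR (- (s * x))))%R @[x --> +oo%R] --> (- (s^-1 * 0))%R by rewrite mulr0 oppr0.
  apply: cvgN; apply: cvgMl_tmp.
  apply: (@cvg_comp _ _ _ (fun x => s * x)%R (fun z => expR (- z)) _ (pinfty_nbhs R)).
    by apply: gt0_cvgMry.
  exact: cvgr_expR.
Qed.

End Gamma.

Lemma integral_gt0 d (T : measurableType d) (R : realType)
    (mu : {measure set T -> \bar R}) (D : set T) (f : T -> \bar R) :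
  measurable D -> (0 < mu D)%E -> measurable_fun D f ->
  (forall x, D x -> 0 < f x)%E -> (0 < \int[mu]_(x in D) f x)%E.
Proof.
move=> mD D0 mf f0.
have f0' x : D x -> (0 <= f x)%E by move=> /f0/ltW.
rewrite lt0e integral_ge0// andbT; apply/eqP => I0.
have [N [mN N0 DN]] : ae_eq mu D f (cst 0%E).
  apply/(ae_eq_integral_abs mu mD mf).1; rewrite -I0.
  by apply: eq_integral => x /set_mem/f0'; exact: gee0_abs.
move: D0; rewrite ltNge => /negP; apply; rewrite -N0 le_measure ?inE// => x Dx.
by apply: DN => /(_ Dx)/= fx; move: (f0 _ Dx); rewrite fx ltxx.
Qed.

Section Gamma.
Variable R : realType.
Notation mu := (@lebesgue_measure R).
Local Open Scope ereal_scope.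

Lemma measurable_eGamma (s : R) (D : set R) :
  measurable_fun D (fun x : R => (x `^ s * expR (- x))%:E).
Proof.
apply: measurable_funTS; have := measurable_powR_exp s (1 : R)%R.
by under eq_fun do rewrite mul1r.
Qed.

(* Scaling gives [v^(-a-1) Gamma(a+1)] as the integral over [s] of [s^a e^(-sv)];
   integrating it over [v >= 1] stays away from the singularity at [0]. *)
Lemma eGammaS (a : R) : (0 < a)%R -> eGamma (a + 1)%R = a%:E * eGamma a.
Proof.
move=> a0.
have exp0 x y z : 0 <= (x `^ z * expR y)%R%:E :> \bar R.
  by rewrite lee_fin mulr_ge0 ?powR_ge0 ?expR_ge0.
pose g (z : R * R) : \bar R := (z.2 `^ (a + 1 - 1) * expR (- (z.1 * z.2)))%:E.
have mg : measurable_fun setT g.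
  apply/measurable_EFinP/measurable_funM.
    exact: (measurableT_comp (measurable_powR (a + 1 - 1)) measurable_snd).
  apply: measurableT_comp; first exact: measurable_expR.
  by apply: measurableT_comp => //; exact: measurable_funM.
suff : (a^-1)%:E * eGamma (a + 1)%R = eGamma a.
  by move=> <-; rewrite muleA -EFinM divff ?gt_eqF// mul1e.
rewrite -integral_powR_tail// -ge0_integralZr//=; last 3 first.
- by apply/measurable_EFinP; apply: measurable_funTS; exact: measurable_powR.
- by move=> x _; rewrite lee_fin powR_ge0.
- exact: eGamma_ge0.
transitivity (\int[mu]_(v in `[1%R, +oo[) \int[mu]_(s in `]0%R, +oo[) g (v, s)).
  apply: eq_integral => v; rewrite inE/= in_itv/= andbT => v1.
  have v0 : (0 < v)%R by exact: lt_le_trans v1.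
  by rewrite /g/= integral_powR_exp// opprD.
rewrite fubini_tonelli_restrict//; last by move=> z; exact: exp0.
apply: eq_integral => s; rewrite inE/= in_itv/= andbT => s0.
under eq_integral do rewrite /g/= EFinM.
rewrite ge0_integralZl//=; last 2 first.
- apply/measurable_EFinP; apply: measurableT_comp; first exact: measurable_expR.
  by apply: measurableT_comp => //; exact: measurable_funM.
- by rewrite lee_fin powR_ge0.
under eq_integral do rewrite mulrC.
rewrite integral_exp_tail// -EFinM; congr EFin.
have -> : (s `^ (a + 1 - 1) = s `^ (a - 1) * s)%R.
  transitivity (s `^ (a - 1) * s `^ 1)%R; last by rewrite powRr1 ?ltW.
  by rewrite -gt0_powRD// addrK subrK.
by field; rewrite gt_eqF.
Qed.

Lemma eGamma1 : eGamma (1 : R) = 1.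
Proof.
rewrite /eGamma subrr; under eq_integral do rewrite powRr0 mul1r.
rewrite integral_itv_obnd_cbnd; last first.
  by apply/measurable_EFinP/measurable_funTS; exact: measurableT_comp.
transitivity (0 - - expR (- 0) : R)%:E; last by rewrite oppr0 expR0 sub0r opprK.
apply: (@ge0_is_derive_FTC2y R (fun x => expR (- x)) (fun x => - expR (- x))%R 0%R 0%R).
- by move=> x _; exact: expR_ge0.
- move=> x _; apply: differentiable_continuous; apply/derivable1_diffP.
  exact: ex_derive.
- by move=> x _; apply: is_derive_eq; rewrite /GRing.scale/=; ring.
- by rewrite -oppr0; apply: cvgN; exact: cvgr_expR.
Qed.

(** For [b] in [[1, 2]], [x^(b-1) <= 1 + x] bounds the integral by those at 1 and 2. The functional
    equation carries finiteness up to larger arguments and back down to those below 1. *)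
Lemma eGamma_fin (a : R) : (0 < a)%R -> eGamma a < +oo.
Proof.
have g1 (b : R) : (1 <= b <= 2)%R -> eGamma b < +oo.
  move=> /andP[b1 b2].
  apply: (@le_lt_trans _ _ (eGamma 1 + eGamma 2)); last first.
    have -> : eGamma (2 : R)%R = eGamma (1 + 1 : R)%R by [].
    by rewrite eGammaS// mul1e eGamma1 ltry.
  rewrite /eGamma -ge0_integralD//=; last 4 first.
  - by move=> x _; rewrite lee_fin mulr_ge0 ?powR_ge0 ?expR_ge0.
  - by exact: measurable_eGamma.
  - by move=> x _; rewrite lee_fin mulr_ge0 ?powR_ge0 ?expR_ge0.
  - by exact: measurable_eGamma.
  apply: ge0_le_integral => //=.
  - by move=> x _; rewrite lee_fin mulr_ge0 ?powR_ge0 ?expR_ge0.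
  - by exact: measurable_eGamma.
  - by apply: emeasurable_funD => //; exact: measurable_eGamma.
  move=> x; rewrite in_itv/= andbT => x0.
  rewrite lee_fin -mulrDl ler_wpM2r ?expR_ge0// subrr powRr0.
  rewrite (_ : 2 - 1 = 1 :> R)%R ?(powRr1 (ltW x0))//; last by ring.
  have [x1|/ltW x1] := leP 1%R x.
    apply: (le_trans (ler_powR x1 (_ : b - 1 <= 1)%R)); first by lra.
    by rewrite powRr1 ?(ltW x0)// lerDr.
  apply: (@le_trans _ _ 1%R); last by rewrite lerDl (ltW x0).
  apply: (@le_trans _ _ (1 `^ (b - 1))%R); last by rewrite powR1.
  apply: ge0_ler_powR => //.
  - by rewrite subr_ge0.
  - by rewrite nnegrE ltW.
  - by rewrite nnegrE.
have gN : forall N (b : R), (1 <= b <= N%:R + 2)%R -> eGamma b < +oo.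
  elim => [|N IH] b; first by rewrite add0r; exact: g1.
  move=> /andP[b1 bN]; have [b2|b2] := leP b 2%R; first by apply: g1; rewrite b1.
  rewrite -(subrK 1%R b) eGammaS; last by lra.
  rewrite lte_mul_pinfty ?lee_fin//; first by lra.
  by apply: IH; move: bN; rewrite -natr1; lra.
move=> a0; have [a1|a1] := leP 1%R a.
  apply: (gN (Num.truncn a)); rewrite a1/=.
  have := truncnS_gt a; rewrite -natr1; lra.
(* Below 1 the functional equation is read backwards: an infinite value at [a] would make the value
   at [a + 1], which lies in [[1, 2]], infinite. *)
have := eGammaS a0 => e.
rewrite ltey; apply/eqP => h; move: e; rewrite h gt0_muley ?lte_fin// => e.
have : eGamma (a + 1)%R < +oo by apply: g1; lra.
by rewrite e ltxx.
Qed.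

Lemma eGamma_gt0 (a : R) : 0 < eGamma a.
Proof.
apply: integral_gt0 => //=.
- by rewrite lebesgue_measure_itv/= ltry addye ?ltry.
- by exact: measurable_eGamma.
- by move=> x; rewrite in_itv/= andbT => x0; rewrite lte_fin mulr_gt0 ?powR_gt0 ?expR_gt0.
Qed.

Lemma eGammaE (a : R) : (0 < a)%R -> eGamma a = (Gamma a)%:E.
Proof.
move=> a0; rewrite /Gamma /Rintegral fineK//; last first.
by rewrite ge0_fin_numE ?eGamma_fin// eGamma_ge0.
Qed.

Lemma Gamma_gt0 (a : R) : (0 < a)%R -> (0 < Gamma a)%R.
Proof. by move=> a0; rewrite -lte_fin -eGammaE// eGamma_gt0. Qed.

Lemma GammaS (a : R) : (0 < a)%R -> Gamma (a + 1) = (a * Gamma a)%R.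
Proof.
move=> a0; apply: EFin_inj; rewrite EFinM -!eGammaE ?eGammaS//.
by rewrite addr_gt0.
Qed.

End Gamma.

(** * Integrals of powers of quadratic functions *)

Section gauss.
Variable R : realType.
Notation mu := (@lebesgue_measure R).
Local Open Scope ereal_scope.

Lemma integral_gauss (a b : R) : (0 < a)%R ->
  \int[mu]_x (expR (- (a * (x - b) ^+ 2)))%:E = (pi `^ 2^-1 * a `^ (- 2^-1))%:E.
Proof.
(* The standard deviation with [2 s^2 = a^-1], so that the integrand is an unnormalized normal
   density. *)
move=> a0; pose s := Num.sqrt (2 * a)^-1.
have s0 : (0 < s)%R by rewrite sqrtr_gt0 invr_gt0 mulr_gt0.
have s2 : (s ^+ 2 *+ 2 = a^-1)%R.
  rewrite sqr_sqrtr ?invr_ge0 ?mulr_ge0 ?ltW// -mulr_natr; field.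
  by rewrite gt_eqF.
have := @integral_normal_pdf R b s.
rewrite /normal_pdf gt_eqF//.
under eq_integral do rewrite EFinM.
rewrite ge0_integralZl//=; last 3 first.
- by apply/measurable_EFinP; exact: measurable_normal_fun.
- by move=> x _; rewrite lee_fin normal_fun_ge0.
- by rewrite lee_fin normal_peak_ge0.
move=> /(congr1 (fun z => (normal_peak s)^-1%:E * z)).
rewrite muleA -EFinM mulVf ?mul1e ?mule1; last by rewrite gt_eqF// normal_peak_gt0 ?gt_eqF.
rewrite /normal_peak invrK mulrC -mulrnAr s2 sqrtrM ?pi_ge0//.
rewrite -!powR12_sqrt ?pi_ge0 ?invr_ge0 ?ltW// => Ig.
transitivity (\int[mu]_x (normal_fun b s x)%:E).
  apply: eq_integral => x _; rewrite /normal_fun s2 invrK mulNr.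
  by rewrite mulrC.
by rewrite Ig -(powR_inv1 (ltW a0)) -powRrM mulN1r.
Qed.

Lemma integral_cauchy (A B b r : R) : (0 < A)%R -> (0 < B)%R -> (2^-1 < r)%R ->
  \int[mu]_u ((A + B * (u - b) ^+ 2) `^ (- r))%:E =
  (A `^ (2^-1 - r) * B `^ (- 2^-1) * (pi `^ 2^-1 * Gamma (r - 2^-1) / Gamma r))%:E.
Proof.
move=> A0 B0 r2.
have r0 : (0 < r)%R by apply: lt_trans r2; rewrite invr_gt0.
have G0 := Gamma_gt0 r0.
have pos u : (0 < A + B * (u - b) ^+ 2)%R.
  by rewrite ltr_wpDr// mulr_ge0 ?sqr_ge0// ltW.
have mq : measurable_fun [set: R] (fun u => A + B * (u - b) ^+ 2)%R.
  apply: measurable_funD => //; apply: measurable_funM => //.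
  by apply: measurable_funX; exact: measurable_funB.
(* Multiplying by [Gamma r] lets [Gamma r * X^(-r)] be replaced by the integral of
   [t^(r-1) e^(-Xt)], after which the variable [u] occurs only in a Gaussian. *)
suff : (Gamma r)%:E * \int[mu]_u ((A + B * (u - b) ^+ 2) `^ (- r))%:E =
    (A `^ (2^-1 - r) * B `^ (- 2^-1) * (pi `^ 2^-1 * Gamma (r - 2^-1)))%:E.
  move=> /(congr1 (fun z => (Gamma r)^-1%:E * z)).
  rewrite muleA -!EFinM mulVf ?gt_eqF// mul1e => ->.
  by congr EFin; ring.
rewrite -ge0_integralZl//=; last 3 first.
- by apply/measurable_EFinP; exact: (measurableT_comp (measurable_powR (- r))).
- by move=> x _; rewrite lee_fin powR_ge0.
- by rewrite lee_fin ltW.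
pose g (z : R * R) : \bar R :=
  (z.2 `^ (r - 1) * expR (- ((A + B * (z.1 - b) ^+ 2) * z.2)))%:E.
have mg : measurable_fun setT g.
  apply/measurable_EFinP/measurable_funM.
    exact: (measurableT_comp (measurable_powR (r - 1)) measurable_snd).
  apply: measurableT_comp; first exact: measurable_expR.
  apply: measurableT_comp => //; apply: measurable_funM => //.
  exact: (measurableT_comp mq measurable_fst).
have g0 z : 0 <= g z by rewrite lee_fin mulr_ge0 ?powR_ge0 ?expR_ge0.
transitivity (\int[mu]_(u in setT) \int[mu]_(t in `]0%R, +oo[) g (u, t)).
  apply: eq_integral => u _.
  by rewrite /g/= integral_powR_exp// muleC eGammaE.
rewrite fubini_tonelli_restrict//.
transitivity (\int[mu]_(t in `]0%R, +oo[)
    ((pi `^ 2^-1 * B `^ (- 2^-1))%:E * (t `^ ((r - 2^-1) - 1) * expR (- (A * t)))%:E)).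
  apply: eq_integral => t; rewrite inE/= in_itv/= andbT => t0.
  transitivity (\int[mu]_u ((t `^ (r - 1) * expR (- (A * t)))%:E *
      (expR (- (B * t * (u - b) ^+ 2)))%:E)).
    apply: eq_integral => u _; rewrite -EFinM; congr EFin => /=.
    rewrite (_ : - _ = - (A * t) + - (B * t * (u - b) ^+ 2))%R; last by ring.
    by rewrite expRD mulrA.
  rewrite ge0_integralZl//=; last 2 first.
  - apply/measurable_EFinP; apply: measurableT_comp; first exact: measurable_expR.
    apply: measurableT_comp => //; apply: measurable_funM => //.
    by apply: measurable_funX; exact: measurable_funB.
  - by rewrite lee_fin mulr_ge0 ?powR_ge0 ?expR_ge0.
  rewrite integral_gauss ?mulr_gt0// -!EFinM powRM ?ltW//; congr EFin.
  (* The Gaussian integral contributes [t^(-1/2)], which turns the remaining Gamma integral from one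
     at [r] into one at [r - 1/2]. *)
  have -> : (t `^ (r - 2^-1 - 1) = t `^ (r - 1) * t `^ (- 2^-1))%R.
    by rewrite -gt0_powRD//; congr (_ `^ _)%R; ring.
  by ring.
rewrite ge0_integralZl//=; last 3 first.
- exact: measurable_funTS (measurable_powR_exp _ _).
- by move=> x _; rewrite lee_fin mulr_ge0 ?powR_ge0 ?expR_ge0.
- by rewrite lee_fin mulr_ge0 ?powR_ge0.
rewrite integral_powR_exp// eGammaE ?subr_gt0// -!EFinM opprB; congr EFin.
by ring.
Qed.

Lemma integral_cauchy_pos (A B r : R) : (0 < A)%R -> (0 < B)%R -> (2^-1 < r)%R ->
  \int[mu]_(u in `]0%R, +oo[) ((A + B * u ^+ 2) `^ (- r))%:E =
  (2^-1 * (A `^ (2^-1 - r) * B `^ (- 2^-1) * (pi `^ 2^-1 * Gamma (r - 2^-1) / Gamma r)))%:E.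
Proof.
move=> A0 B0 r2; rewrite EFinM -(integral_cauchy 0 A0 B0 r2).
under [in RHS]eq_integral do rewrite subr0.
have pos u : (0 < A + B * u ^+ 2)%R by rewrite ltr_wpDr// mulr_ge0 ?sqr_ge0// ltW.
have cq : continuous (fun u : R => (A + B * u ^+ 2) `^ (- r))%R.
  move=> u; apply: (@continuous_comp R R R (fun u : R => A + B * u ^+ 2)%R (fun y : R => y `^ (- r))%R u).
    apply: cvgD; first exact: cvg_cst.
    by apply: cvgMl_tmp; exact: exprn_continuous.
  apply: differentiable_continuous; apply/derivable1_diffP.
  by apply: derivable_powR; rewrite in_itv/= pos.
rewrite ge0_symfun_integralT//; last 2 first.
- by move=> x; exact: powR_ge0.
- by move=> x/=; rewrite sqrrN.
rewrite muleA -EFinM mulVf// mul1e integral_itv_obnd_cbnd ?set_itvcy//.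
by apply/measurable_EFinP/measurable_funTS; exact: continuous_measurable_fun.
Qed.

End gauss.

Definition sqdist (R : realType) m (y b : Rn R m) : R :=
  \sum_(i < m) (tnth y i - tnth b i) ^+ 2.

(** The value of the integral of [(1 + |y|^2)^(-s)] over [R^m] when [s > m / 2]. *)
Definition cauchy_const (R : realType) (m : nat) (s : R) : R :=
  pi `^ (m%:R / 2) * Gamma (s - m%:R / 2) / Gamma s.

Section Rn.
Variable R : realType.
Notation mu := (@lebesgue_measure R).

Lemma sqdist_ge0 m (y b : Rn R m) : 0 <= sqdist y b.
Proof. by apply: sumr_ge0 => i _; exact: sqr_ge0. Qed.

Lemma sqdist_cons m (u v : R) (y b : Rn R m) :
  sqdist (consRn (u, y)) (consRn (v, b)) = (u - v) ^+ 2 + sqdist y b.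
Proof.
rewrite /sqdist big_ord_recl !tnth0; congr (_ + _).
by apply: eq_bigr => i _; rewrite !tnthS.
Qed.

Lemma measurable_sqdist m (b : Rn R m) :
  measurable_fun [set: Rn R m] (fun y => sqdist y b).
Proof.
apply: measurable_sum => i; apply: measurable_funX; apply: measurable_funB => //.
exact: measurable_tnth.
Qed.

Lemma measurable_sqdist_powR m (A B p : R) (b : Rn R m) :
  measurable_fun [set: Rn R m] (fun y => (A + B * sqdist y b) `^ p).
Proof.
apply: (measurableT_comp (measurable_powR p)).
apply: measurable_funD => //; apply: measurable_funM => //.
exact: measurable_sqdist.
Qed.

Local Open Scope ereal_scope.

Lemma ge0_integral_consRn m (F : Rn R m.+1 -> \bar R) :
  measurable_fun setT F -> (forall y, 0 <= F y) ->
  \int[lebesgue_Rn R m.+1]_y F y =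
  \int[mu]_u \int[lebesgue_Rn R m]_y F (consRn (u, y)).
Proof.
move=> mF F0.
have := ge0_integral_pushforward (@measurable_consRn R m)
  (mu \x lebesgue_Rn R m) (D := setT) (f := F) measurableT mF (fun y _ => F0 y).
rewrite preimage_setT => e; rewrite [LHS]e.
rewrite fubini_tonelli1//=.
apply: measurableT_comp => //; exact: measurable_consRn.
Qed.

Lemma consRnE m (b : Rn R m.+1) : exists v c, b = consRn (v, c).
Proof.
by exists (thead b), [tuple of behead b]; rewrite {1}(tuple_eta b); apply/val_inj.
Qed.

(** Induction on the dimension: freezing the first coordinate [u] replaces [A] by [A + B (u - v)^2],
    and the inner integral leaves a one-dimensional one with exponent [s - m / 2]. Its factor [Gamma
    (s - m / 2 - 1/2) / Gamma (s - m / 2)] telescopes with the constant already obtained. *)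
Lemma integral_sqdist_powR m (A B s : R) (b : Rn R m) :
  (0 < A)%R -> (0 < B)%R -> (m%:R / 2 < s)%R ->
  \int[lebesgue_Rn R m]_y ((A + B * sqdist y b) `^ (- s))%:E =
  (A `^ (m%:R / 2 - s) * B `^ (- (m%:R / 2)) * cauchy_const m s)%:E.
Proof.
move=> + B0; elim: m A b => [|m IH] A b A0 ms.
  rewrite /= integral_dirac//=; last first.
    by apply/measurable_EFinP; exact: measurable_sqdist_powR.
  rewrite diracT mul1e /sqdist big_ord0 mulr0 addr0 /cauchy_const.
  rewrite mul0r sub0r subr0 oppr0 !powRr0 mul1r mulr1 divff ?mulr1//.
  by rewrite gt_eqF// Gamma_gt0//; rewrite mul0r in ms.
have [v [c ->]] := consRnE b.
rewrite ge0_integral_consRn; last 2 first.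
- by apply/measurable_EFinP; exact: measurable_sqdist_powR.
- by move=> y; rewrite lee_fin powR_ge0.
have m0 : (0 <= m%:R :> R)%R by [].
have ms' : (m%:R / 2 < s)%R by move: ms; rewrite -natr1; lra.
have ms2 : (2^-1 < s - m%:R / 2)%R by move: ms; rewrite -natr1; lra.
have pos u : (0 < A + B * (u - v) ^+ 2)%R.
  by rewrite ltr_wpDr// mulr_ge0 ?sqr_ge0// ltW.
have C0 : (0 <= B `^ (- (m%:R / 2)) * cauchy_const m s)%R.
  rewrite mulr_ge0 ?powR_ge0// /cauchy_const mulr_ge0 ?invr_ge0 ?mulr_ge0 ?powR_ge0//.
    by rewrite ltW// Gamma_gt0// subr_gt0.
  by rewrite ltW// Gamma_gt0//; lra.
transitivity (\int[mu]_u ((B `^ (- (m%:R / 2)) * cauchy_const m s)%:E *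
    ((A + B * (u - v) ^+ 2) `^ (- (s - m%:R / 2)))%:E)).
  apply: eq_integral => u _.
  under eq_integral do rewrite sqdist_cons mulrDr addrA.
  by rewrite IH// -EFinM opprB; congr EFin; ring.
rewrite ge0_integralZl//=; last 2 first.
- apply/measurable_EFinP; apply: (measurableT_comp (measurable_powR (- (s - m%:R / 2)))).
  apply: measurable_funD => //; apply: measurable_funM => //.
  by apply: measurable_funX; exact: measurable_funB.
- by move=> x _; rewrite lee_fin powR_ge0.
rewrite integral_cauchy// -EFinM; congr EFin.
have Gs : (Gamma (s - m%:R / 2) != 0)%R by rewrite gt_eqF// Gamma_gt0// subr_gt0.
have Gs0 : (Gamma s != 0)%R by rewrite gt_eqF// Gamma_gt0//; lra.
have e1 : (m.+1%:R / 2 = m%:R / 2 + 2^-1 :> R)%R by rewrite -natr1; field.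
rewrite /cauchy_const e1 (gt0_powRD _ _ (pi_gt0 R)) (opprD (m%:R / 2)%R) (gt0_powRD _ _ B0) addrA.
rewrite (_ : 2^-1 - (s - m%:R / 2) = m%:R / 2 + 2^-1 - s)%R; last by ring.
by field; rewrite Gs0 Gs.
Qed.

Lemma cauchy_const_gt0 m (s : R) : (m%:R / 2 < s)%R -> (0 < cauchy_const m s)%R.
Proof.
move=> ms; have s0 : (0 < s)%R by apply: le_lt_trans ms; rewrite divr_ge0.
rewrite /cauchy_const divr_gt0 ?Gamma_gt0// mulr_gt0 ?powR_gt0 ?pi_gt0//.
by rewrite Gamma_gt0// subr_gt0.
Qed.

(** The functional equation applied to both Gamma factors. At [s = (1 - q)^-1 - 1] the prefactor is
    the ratio [rho] between the integrals of the powered and the plain profile. *)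
Lemma cauchy_constS m (s : R) : (m%:R / 2 < s)%R ->
  cauchy_const m s = (s / (s - m%:R / 2) * cauchy_const m (s + 1))%R.
Proof.
move=> ms; have s0 : (0 < s)%R by apply: le_lt_trans ms; rewrite divr_ge0.
have sm : (0 < s - m%:R / 2)%R by rewrite subr_gt0.
rewrite /cauchy_const GammaS// (addrAC s 1%R) GammaS//.
have Gs0 : (Gamma s != 0)%R by rewrite gt_eqF// Gamma_gt0.
have sm' : (s * 2 - m%:R != 0)%R by rewrite gt_eqF//; lra.
by field; rewrite Gs0 sm' gt_eqF.
Qed.

(** The slice at height [u] is a boundary integral with [A] replaced by [A + B u^2]. The integral
    over positive heights is then half of an even one-dimensional integral, hence the factor
    [2^-1]. *)
Lemma integral_half_space_powR n (A B s : R) (b : Rn R n.-1) : (0 < n)%N ->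
  (0 < A)%R -> (0 < B)%R -> (n%:R / 2 < s)%R ->
  \int[lebesgue_space R n]_(x in @half_space R n)
    ((A + B * (sqdist x.1 b + x.2 ^+ 2)) `^ (- s))%:E =
  (2^-1 * (A `^ (n%:R / 2 - s) * B `^ (- (n%:R / 2)) * cauchy_const n s))%:E.
Proof.
case: n b => [//|m] b _ A0 B0 ms; rewrite /lebesgue_space/=.
have m0 : (0 <= m%:R :> R)%R by [].
have ms' : (m%:R / 2 < s)%R by move: ms; rewrite -natr1; lra.
have ms2 : (2^-1 < s - m%:R / 2)%R by move: ms; rewrite -natr1; lra.
pose f (x : Rn R m * R) : \bar R := ((A + B * (sqdist x.1 b + x.2 ^+ 2)) `^ (- s))%:E.
have mf : measurable_fun setT f.
  apply/measurable_EFinP; apply: (measurableT_comp (measurable_powR (- s))).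
  apply: measurable_funD => //; apply: measurable_funM => //.
  apply: measurable_funD.
    exact: (measurableT_comp (measurable_sqdist b) measurable_fst).
  by apply: measurable_funX; exact: measurable_snd.
have f0 z : 0 <= f z by rewrite lee_fin powR_ge0.
have HE : @half_space R m.+1 = setT `*` `]0%R, +oo[%classic.
  by apply/seteqP; split => -[y u]; rewrite /half_space /= in_itv/= andbT => // -[].
have mH : measurable (setT `*` `]0%R, +oo[%classic : set (Rn R m * measurableTypeR R)).
  exact: measurableX.
have -> : (\int[lebesgue_Rn R m \x mu]_(x in @half_space R m.+1) f x =
    \int[mu]_(u in `]0%R, +oo[) \int[lebesgue_Rn R m]_y f (y, u))%E.
  rewrite HE integral_mkcond fubini_tonelli2//; last 2 first.
  - by apply/(measurable_restrictT _ _).1 => //; exact: measurable_funTS.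
  - by move=> z; exact: erestrict_ge0.
  rewrite [RHS]integral_mkcond; apply: eq_integral => u _; rewrite /fubini_G [RHS]patchE.
  case: ifPn => uD.
    by apply: eq_integral => y _; rewrite patchE in_setX uD in_setT.
  by rewrite integral0_eq// => y _; rewrite patchE in_setX (negbTE uD) andbF.
transitivity (\int[mu]_(u in `]0%R, +oo[) ((B `^ (- (m%:R / 2)) * cauchy_const m s)%:E *
    ((A + B * u ^+ 2) `^ (- (s - m%:R / 2)))%:E)).
  apply: eq_integral => u _.
  transitivity (\int[lebesgue_Rn R m]_y ((A + B * u ^+ 2 + B * sqdist y b) `^ (- s))%:E).
    by apply: eq_integral => y _; rewrite /f/=; congr (_ `^ _)%:E; ring.
  rewrite integral_sqdist_powR//; last by rewrite ltr_wpDr// mulr_ge0 ?sqr_ge0// ltW.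
  by rewrite -EFinM opprB; congr EFin; ring.
rewrite ge0_integralZl//=; last 3 first.
- apply/measurable_EFinP; apply: (measurableT_comp (measurable_powR (- (s - m%:R / 2)))).
  apply: measurable_funD => //; apply: measurable_funM => //.
- by move=> x _; rewrite lee_fin powR_ge0.
- by rewrite lee_fin mulr_ge0 ?powR_ge0// ltW// cauchy_const_gt0.
rewrite integral_cauchy_pos// -EFinM; congr EFin.
have Gs : (Gamma (s - m%:R / 2) != 0)%R by rewrite gt_eqF// Gamma_gt0// subr_gt0.
have Gs0 : (Gamma s != 0)%R by rewrite gt_eqF// Gamma_gt0//; lra.
have e1 : (m.+1%:R / 2 = m%:R / 2 + 2^-1 :> R)%R by rewrite -natr1; field.
rewrite /cauchy_const e1 (gt0_powRD _ _ (pi_gt0 R)) (opprD (m%:R / 2)%R) (gt0_powRD _ _ B0) addrA.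
rewrite (_ : 2^-1 - (s - m%:R / 2) = m%:R / 2 + 2^-1 - s)%R; last by ring.
by field; rewrite Gs0 Gs.
Qed.

End Rn.

(** * Moments *)

Section moments.
Variables (R : realType) (m : nat).
Notation mu := (lebesgue_Rn R m).
Implicit Types (f : Rn R m -> R).
Local Open Scope ereal_scope.

Lemma sqdistC (x y : Rn R m) : sqdist x y = sqdist y x.
Proof. by apply: eq_bigr => i _; rewrite -sqrrN opprB. Qed.

(** The parallel axis theorem. A finite second moment about one point [x0] gives finite first
    moments, and expanding [|y - x|^2] about [x0] and completing the square produces the barycenter.
    The shift [u] will hold [x_n^2]. *)
Lemma second_moment_expansion f (M : R) (x0 : Rn R m) :
  measurable_fun setT f -> (forall y, 0 <= f y)%R ->
  \int[mu]_y (f y)%:E = M%:E -> (0 < M)%R ->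
  \int[mu]_y (sqdist y x0 * f y)%:E < +oo ->
  exists (b : Rn R m) (V : R), forall x (u : R),
    \int[mu]_y ((sqdist y x + u) * f y)%:E = (M * (sqdist x b + u) + V)%:E.
Proof.
move=> mf f0 fM M0 fS.
have msq x := @measurable_sqdist R m x.
have intf : mu.-integrable setT (EFin \o f).
  apply/integrableP; split; first exact/measurable_EFinP.
  under eq_integral do rewrite /= ger0_norm//.
  by rewrite fM ltry.
have intS : mu.-integrable setT (fun y => (sqdist y x0 * f y)%:E).
  apply/integrableP; split; first exact/measurable_EFinP/measurable_funM.
  by under eq_integral do rewrite /= ger0_norm ?mulr_ge0 ?sqdist_ge0//.
have mi i : measurable_fun setT (fun y : Rn R m => tnth y i - tnth x0 i)%R.
  by apply: measurable_funB => //; exact: measurable_tnth.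
(* Dominated by mass plus second moment, since [|z| <= 1 + z^2]. *)
have int1 i : mu.-integrable setT (fun y => ((tnth y i - tnth x0 i) * f y)%:E).
  apply: (le_integrable measurableT _ _ (integrableD measurableT intf intS)).
    by apply/measurable_EFinP/measurable_funM => //; exact: mi.
  move=> y _; rewrite /= lee_fin normrM [leRHS]ger0_norm; last first.
    by rewrite addr_ge0 ?mulr_ge0 ?sqdist_ge0.
  rewrite [(`|f y|)%R]ger0_norm// -{2}[f y]mul1r -mulrDl ler_wpM2r//.
  have : ((tnth y i - tnth x0 i) ^+ 2 <= sqdist y x0)%R.
    by rewrite /sqdist (bigD1 i)//= lerDl sumr_ge0// => j _; exact: sqr_ge0.
  rewrite -real_normK ?num_real//; set z := (`|_|)%R => zs.
  by have := sqr_ge0 (z - 1)%R; nra.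
pose B i := fine (\int[mu]_y ((tnth y i - tnth x0 i) * f y)%:E).
have BE i : \int[mu]_y ((tnth y i - tnth x0 i) * f y)%:E = (B i)%:E.
  by rewrite fineK// integrable_fin_num.
pose S := fine (\int[mu]_y (sqdist y x0 * f y)%:E).
have SE : \int[mu]_y (sqdist y x0 * f y)%:E = S%:E.
  by rewrite fineK// integrable_fin_num.
(* With [B] the first moments relative to [x0], these are the barycenter and the second moment about
   it. *)
exists [tuple (tnth x0 i + B i / M)%R | i < m], (S - \sum_i B i ^+ 2 / M)%R => x u.
transitivity (\int[mu]_y ((sqdist y x0 * f y)%:E +
    (\sum_i (2 * (tnth x0 i - tnth x i))%:E * ((tnth y i - tnth x0 i) * f y)%:E +
     (sqdist x0 x + u)%:E * (f y)%:E))).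
  apply: eq_integral => y _.
  under eq_bigr do rewrite -EFinM.
  rewrite sumEFin -!EFinD; congr EFin.
  under eq_bigr do rewrite mulrA.
  rewrite -mulr_suml -!mulrDl addrA addrA; congr ((_ + _) * _)%R.
  rewrite /sqdist -!big_split/=; apply: eq_bigr => i _; ring.
have int2 i : mu.-integrable setT (fun y =>
    (2 * (tnth x0 i - tnth x i))%:E * ((tnth y i - tnth x0 i) * f y)%:E).
  exact: integrableZl.
have int3 : mu.-integrable setT (fun y => (sqdist x0 x + u)%:E * (f y)%:E).
  exact: integrableZl.
rewrite integralD//; last by apply: integrableD => //; exact: integrable_sum.
rewrite integralD//; last exact: integrable_sum.
rewrite integral_sum// SE integralZl// fM.
under eq_bigr do rewrite integralZl// BE -EFinM.
rewrite sumEFin -EFinM -!EFinD; congr EFin.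
have -> : sqdist x [tuple (tnth x0 i + B i / M)%R | i < m] =
    (\sum_i (tnth x i - (tnth x0 i + B i / M)) ^+ 2)%R.
  by apply: eq_bigr => i _; rewrite tnth_mktuple.
have E : (M * \sum_i (tnth x i - (tnth x0 i + B i / M)) ^+ 2 =
    \sum_i (2 * (tnth x0 i - tnth x i) * B i) + sqdist x0 x * M + \sum_i B i ^+ 2 / M)%R.
  rewrite mulr_sumr /sqdist mulr_suml -!big_split/=; apply: eq_bigr => i _.
  by field; rewrite gt_eqF.
by rewrite mulrDr E; ring.
Qed.

Lemma lebesgue_Rn_set1 (b : Rn R m) : (0 < m)%N -> mu [set b] = 0.
Proof.
move=> m0; have -> : [set b] = [set x | forall i, [set tnth b i] (tnth x i)].
  apply/seteqP; split => [x -> //|x /= xb]; exact: eq_from_tnth.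
rewrite (@lebesgue_Rn_box _ _ (fun i => [set tnth b i]))//; case: m m0 b => // k _ b.
by rewrite big_ord_recl lebesgue_measure_set1 mul0e.
Qed.

(** A zero integral would force [f = 0] almost everywhere off [b], and a point is null in positive
    dimension. This gives [V > 0], by which the parameters of the comparison bubble are divided. *)
Lemma integral_sqdist_gt0 f (b : Rn R m) : (0 < m)%N ->
  measurable_fun setT f -> (forall y, 0 <= f y)%R ->
  ~ {ae mu, forall y, f y = 0%R} ->
  0 < \int[mu]_y (sqdist y b * f y)%:E.
Proof.
move=> m0 mf f0 fn0; rewrite lt0e integral_ge0 ?andbT; last first.
  by move=> y _; rewrite lee_fin mulr_ge0 ?sqdist_ge0.
apply/eqP => I0; apply: fn0.
have mh : measurable_fun setT (fun y => (sqdist y b * f y)%:E).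
  by apply/measurable_EFinP/measurable_funM => //; exact: measurable_sqdist.
have := (ae_eq_integral_abs mu measurableT mh).1.
have -> : \int[mu]_y `|(sqdist y b * f y)%:E| = 0.
  by rewrite -I0; apply: eq_integral => y _; rewrite gee0_abs// lee_fin mulr_ge0 ?sqdist_ge0.
move=> /(_ erefl) ae0.
have nb : {ae mu, forall y, y <> b}.
  exists [set b]; split; [|exact: lebesgue_Rn_set1|by move=> y /= /contrapT].
  have -> : [set b] = \bigcap_(i in [set: 'I_m]) ((fun x : Rn R m => tnth x i) @^-1` [set tnth b i]).
    apply/seteqP; split => [x -> //|x /= xb]; apply: eq_from_tnth => i; exact: xb.
  apply: fin_bigcap_measurable => // i _.
  by rewrite -[X in measurable X]setTI; exact: measurable_tnth.
apply: filterS2 ae0 nb => y /(_ I)/= [+] yb; move/eqP.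
rewrite mulf_eq0 => /orP[|/eqP//] /eqP /psumr_eq0P sq; exfalso; apply: yb.
apply: eq_from_tnth => i; apply/eqP; rewrite -subr_eq0 -sqrf_eq0 sq//.
by move=> j _; exact: sqr_ge0.
Qed.

Lemma ge0_integral_eq0 f : measurable_fun setT f -> (forall y, 0 <= f y)%R ->
  \int[mu]_y (f y)%:E = 0 -> {ae mu, forall y, f y = 0%R}.
Proof.
move=> mf f0 I0; have mh : measurable_fun setT (EFin \o f) by exact/measurable_EFinP.
have := (ae_eq_integral_abs mu measurableT mh).1.
have -> : \int[mu]_y `|(EFin \o f) y| = 0.
  by rewrite -I0; apply: eq_integral => y _; rewrite gee0_abs// lee_fin.
by move=> /(_ erefl); apply: filterS => y /(_ I)/= [].
Qed.

End moments.

(** * Maximizing the q-th power integral at given moments *)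

Lemma gt0_powRE (R : realType) (x p : R) : 0 < x -> x `^ p = expR (p * ln x).
Proof. by move=> x0; rewrite /powR gt_eqF. Qed.

(** The tangent line of the concave power [q] at [w]. For [a > 0], dividing by [a^q] and setting
    [d = ln a - ln w] leaves [1 <= q e^((1-q)d) + (1-q) e^(-qd)]; this follows from [e^x >= 1 + x],
    strict for [x <> 0], since the linear terms cancel. *)
Lemma young_powR (R : realType) (q a w : R) : 0 < q < 1 -> 0 <= a -> 0 < w ->
  a `^ q <= q * w `^ (q - 1) * a + (1 - q) * w `^ q ?= iff (a == w).
Proof.
move=> /andP[q0 q1] + w0; rewrite le_eqVlt => /orP[/eqP <-|a0].
  rewrite powR0 ?(gt_eqF q0)// mulr0 add0r.
  have h : 0 < (1 - q) * w `^ q by rewrite mulr_gt0 ?subr_gt0 ?powR_gt0.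
  by split; [exact: ltW|rewrite !lt_eqF].
have -> : q * w `^ (q - 1) * a + (1 - q) * w `^ q =
    a `^ q * (q * expR ((1 - q) * (ln a - ln w)) + (1 - q) * expR (- (q * (ln a - ln w)))).
  rewrite mulrDr !mulrA ![a `^ q * _]mulrC -!mulrA !gt0_powRE// -[X in q * (_ * X)]lnK// -!expRD.
  by congr (q * expR _ + (1 - q) * expR _); ring.
have [<-|aw] := eqVneq a w.
  rewrite subrr !mulr0 oppr0 expR0 !mulr1 addrCA subrr addr0 mulr1.
  by apply/leifP; rewrite eqxx.
have d0 : ln a - ln w != 0.
  by rewrite subr_eq0; apply: contra aw => /eqP/ln_inj -> //; rewrite posrE.
set d := ln a - ln w in d0 *.
apply/leifP; rewrite ltr_pMr ?powR_gt0//.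
have h1 : 1 + (1 - q) * d < expR ((1 - q) * d).
  by apply: expR_gt1Dx; rewrite mulf_neq0// subr_eq0 gt_eqF.
have h2 : 1 - q * d <= expR (- (q * d)) by exact: expR_ge1Dx.
have h3 : q * (1 + (1 - q) * d) < q * expR ((1 - q) * d) by rewrite ltr_pM2l.
have h4 : (1 - q) * (1 - q * d) <= (1 - q) * expR (- (q * d)).
  by rewrite ler_pM2l// subr_gt0.
have := ltr_leD h3 h4; congr (_ < _); ring.
Qed.

Section comparison.
Variables (R : realType) (m : nat) (q : R).
Notation mu := (lebesgue_Rn R m).
Notation sigma := (1 - q)^-1.
Notation I := (cauchy_const m sigma).
Notation rho := ((sigma - 1) / (sigma - 1 - m%:R / 2)).
Hypotheses (q01 : 0 < q < 1) (qm : m%:R / 2 < sigma - 1).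

Let q0 : 0 < q. Proof. by case/andP: q01. Qed.
Let q1 : q < 1. Proof. by case/andP: q01. Qed.

Let profile (L : R) (b y : Rn R m) := (1 + L * sqdist y b) `^ (- sigma).

Let pos L (b y : Rn R m) : 0 < L -> 0 < 1 + L * sqdist y b.
Proof. by move=> L0; rewrite ltr_wpDr// mulr_ge0 ?sqdist_ge0// ltW. Qed.

Lemma integral_profile (L : R) (b : Rn R m) : 0 < L ->
  (\int[mu]_y (profile L b y)%:E = (L `^ (- (m%:R / 2)) * I)%:E)%E.
Proof.
move=> L0; rewrite integral_sqdist_powR//; first by rewrite powR1 mul1r.
by apply: lt_trans qm _; rewrite gtrBl.
Qed.

Lemma profile_powR (L : R) (b y : Rn R m) : 0 < L ->
  profile L b y `^ q = (1 + L * sqdist y b) `^ (- (sigma - 1)).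
Proof.
move=> L0; rewrite /profile -powRrM; congr (_ `^ _).
by field; rewrite subr_eq0 gt_eqF.
Qed.

Lemma profile_powRB1 (L : R) (b y : Rn R m) : 0 < L ->
  profile L b y `^ (q - 1) = 1 + L * sqdist y b.
Proof.
move=> L0; rewrite /profile -powRrM (_ : - sigma * (q - 1) = 1).
  by rewrite powRr1// ltW// pos.
by field; rewrite subr_eq0 gt_eqF.
Qed.

(** This integrates both [profile^q], as [q sigma = sigma - 1], and [(1 + L|y-b|^2) profile]; hence
    the same [rho] governs the power integral and the second moment. *)
Lemma integral_profile_powR (L : R) (b : Rn R m) : 0 < L ->
  (\int[mu]_y ((1 + L * sqdist y b) `^ (- (sigma - 1)))%:E =
   (L `^ (- (m%:R / 2)) * (rho * I))%:E)%E.
Proof.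
move=> L0; rewrite integral_sqdist_powR// powR1 mul1r.
by rewrite cauchy_constS// subrK.
Qed.

(** The last two hypotheses say that the bubble [w = c * profile L b] has mass [M] and second moment
    [V] about [b]. *)
Lemma powR_integral_le (f : Rn R m -> R) (b : Rn R m) (c L M V Q : R) :
  0 < c -> 0 < L -> measurable_fun setT f -> (forall y, 0 <= f y) ->
  (\int[mu]_y (f y)%:E = M%:E)%E ->
  (\int[mu]_y (sqdist y b * f y)%:E = V%:E)%E ->
  (\int[mu]_y (f y `^ q)%:E = Q%:E)%E ->
  M = c * (L `^ (- (m%:R / 2)) * I) -> M + L * V = rho * M ->
  Q <= c `^ q * (L `^ (- (m%:R / 2)) * (rho * I)) /\
  (Q = c `^ q * (L `^ (- (m%:R / 2)) * (rho * I)) ->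
   {ae mu, forall y, f y = c * profile L b y}).
Proof.
move=> c0 L0 mf f0 fM fV fQ Mc MV.
set G := c `^ q * _.
pose w y := c * profile L b y.
have w0 y : 0 < w y by rewrite mulr_gt0// powR_gt0// pos.
have ms := @measurable_sqdist R m b.
have mw : measurable_fun setT w.
  by apply: measurable_funM => //; exact: measurable_sqdist_powR.
have mpow g p : measurable_fun setT g -> measurable_fun setT (fun y : Rn R m => g y `^ p).
  by move=> mg; exact: (measurableT_comp (measurable_powR p)).
(* The gap in the concavity inequality. Its integral will be [G - Q], so nonnegativity gives the
   bound and a zero integral gives [f = w] almost everywhere. *)
pose h y := q * w y `^ (q - 1) * f y + (1 - q) * w y `^ q - f y `^ q.
have yg y := young_powR q01 (f0 y) (w0 y).
have h0 y : 0 <= h y by rewrite subr_ge0; exact: yg.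
have mh : measurable_fun setT h.
  apply: measurable_funB; last exact: mpow.
  apply: measurable_funD; last by apply: measurable_funM => //; exact: mpow.
  by apply: measurable_funM => //; apply: measurable_funM => //; exact: mpow.
have Iw : (\int[mu]_y (w y `^ q)%:E = G%:E)%E.
  transitivity (\int[mu]_y ((c `^ q)%:E * ((1 + L * sqdist y b) `^ (- (sigma - 1)))%:E))%E.
    apply: eq_integral => y _; rewrite /w powRM ?powR_ge0 ?ltW//.
    by rewrite -/(profile L b y) profile_powR// EFinM.
  rewrite ge0_integralZl//=; last 3 first.
  - by apply/measurable_EFinP; exact: measurable_sqdist_powR.
  - by move=> y _; rewrite lee_fin powR_ge0.
  - by rewrite lee_fin powR_ge0.
  by rewrite integral_profile_powR.
(* As [w^(q-1) = c^(q-1) (1 + L|y-b|^2)], only the moments of [f] enter: the integral is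
   [c^(q-1) (M + L V) = c^(q-1) rho M], the same as for [w] itself. *)
have Iwf : (\int[mu]_y (w y `^ (q - 1) * f y)%:E = G%:E)%E.
  transitivity (\int[mu]_y ((c `^ (q - 1))%:E * ((f y)%:E + L%:E * (sqdist y b * f y)%:E)))%E.
    apply: eq_integral => y _; rewrite /w powRM ?powR_ge0 ?ltW//.
    rewrite -/(profile L b y) profile_powRB1// -(EFinM L) -EFinD -EFinM; congr EFin.
    by ring.
  rewrite ge0_integralZl//=; last 3 first.
  - apply/measurable_EFinP; apply: measurable_funD => //.
    by apply: measurable_funM => //; exact: measurable_funM.
  - by move=> y _; rewrite lee_fin addr_ge0// !mulr_ge0 ?sqdist_ge0// ltW.
  - by rewrite lee_fin powR_ge0.
  rewrite ge0_integralD//=; last 4 first.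
  - by move=> y _; rewrite lee_fin.
  - exact/measurable_EFinP.
  - by move=> y _; rewrite lee_fin !mulr_ge0 ?sqdist_ge0// ltW.
  - by apply/measurable_EFinP; apply: measurable_funM => //; exact: measurable_funM.
  rewrite ge0_integralZl//=; last 3 first.
  - by apply/measurable_EFinP; exact: measurable_funM.
  - by move=> y _; rewrite lee_fin mulr_ge0 ?sqdist_ge0.
  - by rewrite lee_fin ltW.
  rewrite fM fV -(EFinM L) -EFinD -EFinM MV Mc /G; congr EFin.
  have -> : c `^ q = c `^ (q - 1) * c.
    by rewrite -{3}(powRr1 (ltW c0)) -gt0_powRD// subrK.
  by ring.
have Ih : (\int[mu]_y (h y)%:E + Q%:E = G%:E)%E.
  rewrite -fQ -ge0_integralD//=; last 4 first.
  - by move=> y _; rewrite lee_fin.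
  - exact/measurable_EFinP.
  - by move=> y _; rewrite lee_fin powR_ge0.
  - by apply/measurable_EFinP; exact: mpow.
  transitivity (\int[mu]_y (q%:E * (w y `^ (q - 1) * f y)%:E +
      (1 - q)%:E * (w y `^ q)%:E))%E.
    apply: eq_integral => y _; rewrite -!EFinM -!EFinD; congr EFin.
    by rewrite /h subrK mulrA.
  rewrite ge0_integralD//=; last 4 first.
  - by move=> y _; rewrite lee_fin !mulr_ge0 ?powR_ge0// ltW.
  - by apply/measurable_EFinP; apply: measurable_funM => //; apply: measurable_funM => //; exact: mpow.
  - by move=> y _; rewrite lee_fin !mulr_ge0 ?powR_ge0// subr_ge0 ltW.
  - by apply/measurable_EFinP; apply: measurable_funM => //; exact: mpow.
  rewrite !ge0_integralZl//=.
  all: try by [rewrite lee_fin ?subr_ge0 ltW].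
  all: try by [move=> y _; rewrite lee_fin ?mulr_ge0 ?powR_ge0].
  - by rewrite Iw Iwf -!EFinM -EFinD; congr EFin; ring.
  - by apply/measurable_EFinP; exact: mpow.
  - by apply/measurable_EFinP; apply: measurable_funM => //; exact: mpow.
have Ih0 : (0 <= \int[mu]_y (h y)%:E)%E by apply: integral_ge0 => y _; rewrite lee_fin.
split; first by rewrite -lee_fin -Ih leeDr.
move=> QG; have : (\int[mu]_y (h y)%:E = 0)%E.
  have : (\int[mu]_y (h y)%:E = G%:E - Q%:E)%E by rewrite -Ih addeK.
  by rewrite -EFinB QG subrr.
move=> /(ge0_integral_eq0 mh h0); apply: filterS => y /eqP.
rewrite /h subr_eq0 eq_sym => hy.
by apply/eqP; rewrite -(yg y).2.
Qed.

End comparison.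

(** * The extremal value *)

Ltac positivity := rewrite ?posrE; repeat first
  [assumption | exact: pi_gt0 | apply: mulr_gt0 | rewrite invr_gt0 | apply: powR_gt0 | by rewrite ltr0n].

(** Both sides are products of powers of positive numbers, so taking logarithms turns the claim into
    a rational identity in the exponents, linear in the logarithms. The disappearance of [c] and [L]
    on the right is the invariance under multiples and dilations. *)
Lemma sharp_quotientE (R : realType) (m n q t' gm c L P S G1 G2 G3 G4 : R) :
  0 < m -> n = m + 1 -> 0 < q -> q < 1 -> t' < 0 ->
  1 - gm = q * (2 + n / t') / (m * (1 - q)) ->
  0 < c -> 0 < L -> 0 < P -> 0 < S -> 0 < G1 -> 0 < G2 -> 0 < G3 -> 0 < G4 ->
  let I := pi `^ (m / 2) * G2 / G1 in
  let K := pi `^ (n / 2) * G3 / G4 in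
  let M := c * (L `^ (- (m / 2)) * I) in
  let V := S * M / L in
  let Q := c `^ q * (L `^ (- (m / 2)) * (P^-1 * I)) in
  (2^-1 * (V `^ (n / 2 + t') * M `^ (- (n / 2)) * K)) `^ t'^-1 /
    (M `^ gm * (Q `^ q^-1) `^ (1 - gm)) =
  pi^-1 * (P `^ ((n + 2 * t') / (m * (1 - q))) * S `^ (n / 2 + t') *
    (G1 / G2) `^ ((n + 2 * t') / m) * (G3 / (2 * G4))) `^ t'^-1.
Proof.
move=> m0 -> q0 q1 t0 gmE c0 L0 P0 S0 G10 G20 G30 G40 I K M V Q.
have lnP (x : R) r : ln (x `^ r) = r * ln x by exact: ln_powR.
have lnMp (x y : R) : 0 < x -> 0 < y -> ln (x * y) = ln x + ln y by exact: lnM.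
have lnVp (x : R) : 0 < x -> ln x^-1 = - ln x by exact: lnV.
have I0 : 0 < I by rewrite /I; positivity.
have K0 : 0 < K by rewrite /K; positivity.
have M0 : 0 < M by rewrite /M; positivity.
have V0 : 0 < V by rewrite /V; positivity.
have Q0 : 0 < Q by rewrite /Q; positivity.
apply: (@ln_inj R); [by positivity | by positivity |].
rewrite /Q /V /M /I /K.
repeat first [rewrite lnP | rewrite lnVp; last by positivity
  | rewrite lnMp; [|by positivity|by positivity]].
have -> : gm = 1 - q * (2 + (m + 1) / t') / (m * (1 - q)) by rewrite -gmE; ring.
field.
by rewrite (lt_eqF t0) !gt_eqF ?subr_gt0.
Qed.

Lemma epow_EFin (R : realType) (x p : R) : 0 < x -> epow x%:E p = (x `^ p)%:E.
Proof.
move=> x0; rewrite /epow; case: ifPn => // _.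
by rewrite poweR_EFin inver gt_eqF ?powR_gt0// powRN invrK.
Qed.

(** * Norms and extension expressed through mass and second moment *)

Section functionals.
Variables (R : realType) (m : nat).
Notation mu := (lebesgue_Rn R m).
Implicit Types (f : Rn R m -> R).

Lemma int_powE p f : 0 < p -> (forall y, 0 <= f y) ->
  int_pow mu setT p (EFin \o f) = (\int[mu]_y (f y `^ p)%:E)%E.
Proof.
move=> p0 f0; apply: eq_integral => y _.
by rewrite /epow (ltW p0)/= ger0_norm.
Qed.

Lemma int_pow1E f : (forall y, 0 <= f y) ->
  int_pow mu setT 1 (EFin \o f) = (\int[mu]_y (f y)%:E)%E.
Proof. by move=> f0; rewrite int_powE//; apply: eq_integral => y _; rewrite powRr1. Qed.

Lemma norm_boundaryE p f Q : 0 < p -> (forall y, 0 <= f y) ->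
  (\int[mu]_y (f y `^ p)%:E = Q%:E)%E -> 0 < Q ->
  @norm_boundary R m.+1 p f = (Q `^ p^-1)%:E.
Proof.
by move=> p0 f0 fQ Q0; rewrite /norm_boundary /lp_norm int_powE// fQ epow_EFin.
Qed.

Lemma norm_boundary1E f M : (forall y, 0 <= f y) ->
  (\int[mu]_y (f y)%:E = M%:E)%E -> 0 < M -> @norm_boundary R m.+1 1 f = M%:E.
Proof.
move=> f0 fM M0; rewrite (@norm_boundaryE 1 f M)// ?invr1 ?powRr1 ?ltW//.
by rewrite -fM; apply: eq_integral => y _; rewrite powRr1.
Qed.

Lemma ge0_integral_gt0 f : measurable_fun setT f -> (forall y, 0 <= f y) ->
  ~ {ae mu, forall y, f y = 0} -> (0 < \int[mu]_y (f y)%:E)%E.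
Proof.
move=> mf f0 fn0; rewrite lt0e integral_ge0 ?andbT; last by move=> y _; rewrite lee_fin.
by apply/eqP => I0; apply: fn0; exact: ge0_integral_eq0.
Qed.

Lemma admissibleP q f : 0 < q ->
  @admissible R m.+1 q f <->
  [/\ measurable_fun setT f, forall y, 0 <= f y &
   exists M Q, [/\ 0 < M, 0 < Q, (\int[mu]_y (f y)%:E = M%:E)%E &
     (\int[mu]_y (f y `^ q)%:E = Q%:E)%E]].
Proof.
move=> q0; split.
  move=> [f0 [mf f1] [_ fq] fn0]; split => //.
  move: f1 fq; rewrite int_pow1E// int_powE// => f1 fq.
  have mfq : measurable_fun setT (fun y => f y `^ q).
    exact: (measurableT_comp (measurable_powR q)).
  have M0 := ge0_integral_gt0 mf f0 fn0.
  have Q0 : (0 < \int[mu]_y (f y `^ q)%:E)%E.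
    apply: ge0_integral_gt0 => //; first by move=> y; exact: powR_ge0.
    by move=> ae0; apply: fn0; apply: filterS ae0 => y /powR_eq0_eq0.
  exists (fine (\int[mu]_y (f y)%:E)%E), (fine (\int[mu]_y (f y `^ q)%:E)%E).
  by split; rewrite ?fine_gt0 ?M0 ?Q0// fineK// ge0_fin_numE// ltW.
move=> [mf f0 [M [Q [M0 Q0 fM fQ]]]]; split => //.
- by split => //; rewrite int_pow1E// fM ltry.
- by split => //; rewrite int_powE// fQ ltry.
move=> ae0; have : (\int[mu]_y (f y)%:E = \int[mu]_y 0%:E)%E.
  apply: ge0_ae_eq_integral => //.
  - exact/measurable_EFinP.
  - by move=> y _; rewrite lee_fin.
  - by apply: filterS ae0 => y -> _.
by rewrite integral0 fM => -[M00]; rewrite M00 ltxx in M0.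
Qed.

(** The kernel exponent [alpha - n] is 2, which removes the square root in the distance and leaves a
    quadratic polynomial. *)
Lemma extensionE f x : @extension R m.+1 (m.+1%:R + 2) f x =
  (\int[mu]_y ((sqdist y x.1 + x.2 ^+ 2) * f y)%:E)%E.
Proof.
apply: eq_integral => y _; congr (_ * _)%:E.
rewrite addrAC subrr add0r /dist_boundary.
have d0 : 0 <= sqdist y x.1 + x.2 ^+ 2 by rewrite addr_ge0 ?sqdist_ge0 ?sqr_ge0.
rewrite -[X in Num.sqrt (X + _)]/(sqdist x.1 y) (sqdistC x.1).
by rewrite powR_mulrn ?sqrtr_ge0// sqr_sqrtr.
Qed.

(** Finiteness of the extension at a single point bounds the second moment about its projection to
    the boundary, and the parallel axis formula then gives the extension everywhere. *)
Lemma extension_quadratic f M x :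
  (0 < m)%N -> measurable_fun setT f -> (forall y, 0 <= f y) ->
  (\int[mu]_y (f y)%:E = M%:E)%E -> 0 < M ->
  (@extension R m.+1 (m.+1%:R + 2) f x < +oo)%E ->
  exists b V, [/\ 0 < V, (\int[mu]_y (sqdist y b * f y)%:E = V%:E)%E &
    forall z u, (\int[mu]_y ((sqdist y z + u) * f y)%:E = (V + M * (sqdist z b + u))%:E)%E].
Proof.
move=> m0 mf f0 fM M0; rewrite extensionE => fx.
have mm u z : measurable_fun setT (fun y => ((sqdist y z + u) * f y)%:E).
  apply/measurable_EFinP; apply: measurable_funM => //.
  by apply: measurable_funD => //; exact: measurable_sqdist.
have [|b [V bV]] := @second_moment_expansion _ _ f M x.1 mf f0 fM M0.
  apply: le_lt_trans fx; apply: ge0_le_integral => //=.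
    - by move=> y _; rewrite lee_fin mulr_ge0 ?sqdist_ge0.
  - have := mm 0 x.1; by under eq_fun do rewrite addr0.
  - by move=> y _; rewrite lee_fin ler_wpM2r// lerDl sqr_ge0.
have bV' : (\int[mu]_y (sqdist y b * f y)%:E = V%:E)%E.
  have := bV b 0; under eq_integral do rewrite addr0.
  move=> ->; rewrite /sqdist big1 ?addr0 ?mulr0 ?add0r// => i _.
  by rewrite subrr expr0n.
exists b, V; split => //; last by move=> z u; rewrite bV addrC.
rewrite -lte_fin -bV'; apply: integral_sqdist_gt0 => //.
move=> ae0; have : (\int[mu]_y (f y)%:E = \int[mu]_y 0%:E)%E.
  apply: ge0_ae_eq_integral => //.
  - exact/measurable_EFinP.
  - by move=> y _; rewrite lee_fin.
  - by apply: filterS ae0 => y -> _.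
by rewrite integral0 fM => -[M00]; rewrite M00 ltxx in M0.
Qed.

Lemma norm_half_space_quadratic (F : Rn R m * measurableTypeR R -> \bar R) (M V s : R) b :
  0 < M -> 0 < V -> m.+1%:R / 2 < - s ->
  (forall x, F x = (V + M * (sqdist x.1 b + x.2 ^+ 2))%:E) ->
  @norm_half_space R m.+1 s F =
  ((2^-1 * (V `^ (m.+1%:R / 2 + s) * M `^ (- (m.+1%:R / 2)) *
     cauchy_const m.+1 (- s))) `^ s^-1)%:E.
Proof.
move=> M0 V0 ms FE; rewrite /norm_half_space /lp_norm.
have -> : int_pow (lebesgue_space R m.+1) (@half_space R m.+1) s F =
    (2^-1 * (V `^ (m.+1%:R / 2 + s) * M `^ (- (m.+1%:R / 2)) * cauchy_const m.+1 (- s)))%:E.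
  have := @integral_half_space_powR R m.+1 V M (- s) b isT V0 M0 ms.
  rewrite opprK => <-; apply: eq_integral => x _.
  have pos : 0 < V + M * (sqdist x.1 b + x.2 ^+ 2).
    by rewrite ltr_wpDr// mulr_ge0 ?(ltW M0)// addr_ge0 ?sqdist_ge0 ?sqr_ge0.
  by rewrite FE /= gtr0_norm// epow_EFin.
rewrite epow_EFin// mulr_gt0 ?invr_gt0// mulr_gt0 ?cauchy_const_gt0//.
by rewrite mulr_gt0 ?powR_gt0.
Qed.

(** The conventions for negative exponents act twice: the integrand [(+oo)^s] is 0, and the outer
    power [0^(1/s)] is [+oo]. *)
Lemma norm_half_space_pinfty (F : Rn R m * measurableTypeR R -> \bar R) (s : R) :
  s < 0 -> (forall x, @half_space R m.+1 x -> F x = +oo%E) ->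
  @norm_half_space R m.+1 s F = +oo%E.
Proof.
move=> s0 FE; rewrite /norm_half_space /lp_norm.
have e0 (x : R) : (x < 0)%R -> (0 <= x)%R = false by move=> x0; apply/negbTE; rewrite -ltNge.
have -> : int_pow (lebesgue_space R m.+1) (@half_space R m.+1) s F = 0%E.
  apply: integral0_eq => x /FE ->; rewrite /epow e0//=.
  by rewrite eqr_oppLR oppr0 lt_eqF.
rewrite /epow e0 ?invr_lt0// poweR0r ?inve0//.
by rewrite oppr_eq0 invr_eq0 lt_eqF.
Qed.

End functionals.

Lemma npos_ler_powR (R : realType) (r x y : R) : r <= 0 -> 0 < x -> x <= y ->
  y `^ r <= x `^ r.
Proof.
move=> r0 x0 xy; have y0 := lt_le_trans x0 xy.
by rewrite !gt0_powRE// ler_expR ler_wnM2l// ler_ln.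
Qed.

Lemma bubbleE (R : realType) m (q l : R) (b y : Rn R m) :
  @bubble R m.+1 q (@translate_dilate R m.+1 l b y) =
  (1 + l ^+ 2 * sqdist y b) `^ (- (1 - q)^-1).
Proof.
rewrite /bubble /sqdist mulr_sumr; congr ((1 + _) `^ _).
by apply: eq_bigr => i _; rewrite tnth_mktuple exprMn.
Qed.

(** * Sharp constant and characterization of the extremal functions *)

Section main.
Variables (R : realType) (m : nat) (t q t' : R).
Notation mu := (lebesgue_Rn R m).
Notation n := (m.+1%:R : R).
Notation sigma := (1 - q)^-1.
Notation I := (cauchy_const m sigma).
Notation P := ((q * (n + 1) - n + 1) / (2 * q)).
Notation S := (((n - 1) * (1 - q)) / (q * (n + 1) - n + 1)).
Notation rho := ((sigma - 1) / (sigma - 1 - m%:R / 2)).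
Notation gm := (@gamma_tilde R m.+1 (n + 2) q t).
Hypotheses (m0 : (0 < m)%N) (tt' : conj_exponent t = t').
Hypotheses (t'n : n / 2 < - t') (q0 : 0 < q) (q1 : q < 1) (qn : (n - 1) / (n + 1) < q).

Let mR : 0 < m%:R :> R. Proof. by rewrite ltr0n. Qed.
Let nE : n = m%:R + 1. Proof. by rewrite -natr1. Qed.
Let t'0 : t' < 0. Proof. have : 0 < n by []; move: t'n; lra. Qed.
Let DP : 0 < q * (n + 1) - n + 1.
Proof. by move: qn; rewrite nE ltr_pdivrMr; [lra|have := mR; lra]. Qed.
Let q01 : 0 < q < 1. Proof. by rewrite q0. Qed.
(** Since [sigma - 1 = q / (1 - q)], this is the lower bound on [q] rewritten. *)
Let qm : m%:R / 2 < sigma - 1.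
Proof.
have -> : sigma - 1 = q / (1 - q) by field; rewrite subr_eq0 gt_eqF.
by rewrite ltr_pdivlMr ?subr_gt0//; move: DP; rewrite nE; lra.
Qed.
Let P0 : 0 < P. Proof. by rewrite divr_gt0// mulr_gt0. Qed.
Let S0 : 0 < S.
Proof. by rewrite divr_gt0// mulr_gt0 ?subr_gt0// nE; have := mR; lra. Qed.
Let rhoP : rho = P^-1.
Proof.
rewrite nE; have := DP; rewrite nE => D0; field.
by rewrite (gt_eqF q0) (gt_eqF D0) gt_eqF ?subr_gt0.
Qed.
Let rhoS : rho = 1 + S.
Proof.
rewrite rhoP nE; have := DP; rewrite nE => D0; field.
by rewrite !gt_eqF.
Qed.
Let rho0 : 0 < rho. Proof. by rewrite rhoP invr_gt0. Qed.
Let I0 : 0 < I.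
Proof. by apply: cauchy_const_gt0; apply: lt_trans qm _; rewrite gtrBl. Qed.
Let gmE : 1 - gm = q * (2 + n / t') / (m%:R * (1 - q)).
Proof.
rewrite /gamma_tilde tt' nE; field.
by rewrite (lt_eqF t'0) (gt_eqF mR) gt_eqF ?subr_gt0.
Qed.
(** Equivalent to [n / 2 < - t']; it makes the denominator [D M Q] increase with [Q]. *)
Let gm1 : 0 < 1 - gm.
Proof.
rewrite gmE divr_gt0 ?mulr_gt0 ?subr_gt0//.
rewrite -ltrBlDl sub0r -ltrN2 opprK -mulrN -invrN ltr_pdivrMr ?oppr_gt0//.
by move: t'n; lra.
Qed.

Let N (M V : R) := (2^-1 * (V `^ (n / 2 + t') * M `^ (- (n / 2)) *
  cauchy_const m.+1 (- t'))) `^ t'^-1.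
Let D (M Q : R) := M `^ gm * (Q `^ q^-1) `^ (1 - gm).
(* The bubble [c (1 + L |y-b|^2)^(-sigma)] of mass [M] and second moment [V]
   about [b] has [L = optL M V], [c = optc M V] and q-th power integral [optQ M V]. *)
Let optL (M V : R) := S * M / V.
Let optc (M V : R) := M * optL M V `^ (m%:R / 2) / I.
Let optQ (M V : R) :=
  optc M V `^ q * (optL M V `^ (- (m%:R / 2)) * (rho * I)).

Definition sharp_value : R :=
  pi^-1 * (P `^ ((n + 2 * t') / ((n - 1) * (1 - q))) * S `^ (n / 2 + t') *
   (Gamma sigma / Gamma (sigma - (n - 1) / 2)) `^ ((n + 2 * t') / (n - 1)) *
   (Gamma (- t' - n / 2) / (2 * Gamma (- t')))) `^ t'^-1.

Section params.
Variables (M V : R).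
Hypotheses (M0 : 0 < M) (V0 : 0 < V).

Let L0 : 0 < optL M V. Proof. by rewrite divr_gt0// mulr_gt0. Qed.
Let c0 : 0 < optc M V. Proof. by rewrite divr_gt0// mulr_gt0// powR_gt0. Qed.

Lemma mass_opt : M = optc M V * (optL M V `^ (- (m%:R / 2)) * I).
Proof.
rewrite /optc powRN; field.
by rewrite !gt_eqF// powR_gt0.
Qed.

Lemma moment_opt : M + optL M V * V = rho * M.
Proof. by rewrite rhoS /optL divfK ?gt_eqF//; ring. Qed.

Lemma optQ_gt0 : 0 < optQ M V.
Proof.
by apply: mulr_gt0; [exact: powR_gt0|apply: mulr_gt0; [exact: powR_gt0|exact: mulr_gt0]].
Qed.

Lemma quotient_opt : N M V / D M (optQ M V) = sharp_value.
Proof.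
have G1 : 0 < Gamma sigma by rewrite Gamma_gt0// invr_gt0 subr_gt0.
have G2 : 0 < Gamma (sigma - m%:R / 2).
  by rewrite Gamma_gt0// subr_gt0; apply: lt_trans qm _; rewrite gtrBl.
have G3 : 0 < Gamma (- t' - n / 2) by rewrite Gamma_gt0// subr_gt0.
have G4 : 0 < Gamma (- t') by rewrite Gamma_gt0// oppr_gt0.
have := @sharp_quotientE R m%:R n q t' gm (optc M V) (optL M V) P S _ _ _ _
  mR nE q0 q1 t'0 gmE c0 L0 P0 S0 G1 G2 G3 G4.
rewrite -/(cauchy_const m sigma) -/(cauchy_const m.+1 (- t')) /=.
rewrite -mass_opt -rhoP -/(optQ M V).
(* [sharp_quotientE] expresses the second moment through [L]; this inverts the definition of
   [optL]. *)
have -> : S * M / optL M V = V.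
  by rewrite /optL invf_div mulrCA mulfV ?mulr1// gt_eqF// mulr_gt0.
rewrite -/(N M V) -/(D M (optQ M V)) => ->.
have n1 : n - 1 = m%:R by rewrite nE addrK.
by rewrite /sharp_value n1.
Qed.

End params.

Lemma rhs_normsE f M Q : (forall y, 0 <= f y) -> 0 < M -> 0 < Q ->
  (\int[mu]_y (f y)%:E = M%:E)%E -> (\int[mu]_y (f y `^ q)%:E = Q%:E)%E ->
  @rhs_norms R m.+1 (n + 2) q t f = (D M Q)%:E.
Proof.
move=> f0 M0 Q0 fM fQ; rewrite /rhs_norms (norm_boundary1E f0 fM M0).
by rewrite (norm_boundaryE q0 f0 fQ Q0) !epow_EFin ?powR_gt0.
Qed.

Let D_gt0 M Q : 0 < M -> 0 < Q -> 0 < D M Q.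
Proof. by move=> M0 Q0; rewrite mulr_gt0// !powR_gt0// powR_gt0. Qed.

Let N_gt0 M V : 0 < M -> 0 < V -> 0 < N M V.
Proof.
move=> M0 V0; rewrite powR_gt0// mulr_gt0 ?invr_gt0// mulr_gt0 ?cauchy_const_gt0//.
by rewrite mulr_gt0 ?powR_gt0.
Qed.

Lemma quotient_pinfty f M Q : (forall y, 0 <= f y) -> 0 < M -> 0 < Q ->
  (\int[mu]_y (f y)%:E = M%:E)%E -> (\int[mu]_y (f y `^ q)%:E = Q%:E)%E ->
  (forall x, @half_space R m.+1 x -> @extension R m.+1 (n + 2) f x = +oo%E) ->
  @quotient R m.+1 (n + 2) q t f = +oo%E.
Proof.
move=> f0 M0 Q0 fM fQ foo; rewrite /quotient tt' (norm_half_space_pinfty t'0 foo).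
rewrite (rhs_normsE f0 M0 Q0 fM fQ) inver gt_eqF ?D_gt0//.
by rewrite gt0_mulye// lte_fin invr_gt0 D_gt0.
Qed.

Lemma quotient_fin f M Q V b : (forall y, 0 <= f y) -> 0 < M -> 0 < Q -> 0 < V ->
  (\int[mu]_y (f y)%:E = M%:E)%E -> (\int[mu]_y (f y `^ q)%:E = Q%:E)%E ->
  (forall z u, \int[mu]_y ((sqdist y z + u) * f y)%:E = (V + M * (sqdist z b + u))%:E)%E ->
  @quotient R m.+1 (n + 2) q t f = (N M V / D M Q)%:E.
Proof.
move=> f0 M0 Q0 V0 fM fQ fV; rewrite /quotient tt' (rhs_normsE f0 M0 Q0 fM fQ).
rewrite (@norm_half_space_quadratic _ _ _ M V _ b)//.
  by rewrite inver gt_eqF ?D_gt0// -EFinM.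
by move=> x; rewrite extensionE fV.
Qed.

Let D_mono M Q Q' : 0 < M -> 0 < Q -> Q < Q' -> D M Q < D M Q'.
Proof.
move=> M0 Q0 QQ'; have Q'0 := lt_trans Q0 QQ'.
rewrite ltr_pM2l ?powR_gt0// gt0_ltr_powR ?nnegrE ?powR_ge0//.
by rewrite gt0_ltr_powR ?nnegrE ?invr_gt0// ltW.
Qed.

Let optimal_gt0 M V : 0 < M -> 0 < V -> 0 < optL M V /\ 0 < optc M V.
Proof.
move=> M0 V0; have L0 : 0 < optL M V by rewrite divr_gt0// mulr_gt0.
by split => //; rewrite divr_gt0// mulr_gt0// powR_gt0.
Qed.

Lemma quotient_ge f : @admissible R m.+1 q f ->
  (sharp_value%:E <= @quotient R m.+1 (n + 2) q t f)%E /\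
  (@quotient R m.+1 (n + 2) q t f = sharp_value%:E ->
   exists (c l : R) (x0 : Rn R m), [/\ 0 < c, 0 < l &
     {ae mu, forall x, f x = c * @bubble R m.+1 q (@translate_dilate R m.+1 l x0 x)}]).
Proof.
move=> /(admissibleP _ q0)[mf f0 [M [Q [M0 Q0 fM fQ]]]].
(* One point of finiteness gives the quadratic form of the extension. Otherwise the extension is
   infinite everywhere, and so is the quotient. *)
have [[x fx]|foo] := pselect (exists x, (@extension R m.+1 (n + 2) f x < +oo)%E); last first.
  rewrite (quotient_pinfty f0 M0 Q0 fM fQ); first by rewrite leey.
  by move=> x _; apply: contra_notP foo => /eqP; rewrite -ltey; exists x.
have [b [V [V0 bV fV]]] := extension_quadratic m0 mf f0 fM M0 fx.
rewrite (quotient_fin f0 M0 Q0 V0 fM fQ fV) -(quotient_opt M0 V0).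
have [L0 c0] := optimal_gt0 M0 V0.
have [Qle Qeq] := powR_integral_le q01 qm c0 L0 mf f0 fM bV fQ
  (mass_opt M0 V0) (moment_opt M V0).
rewrite -/(optQ M V) in Qle Qeq.
have NV := N_gt0 M0 V0.
(* If [Q] reaches the maximum, [f] is the comparison bubble almost everywhere. Otherwise [D] is
   strictly smaller and the quotient strictly larger, which excludes equality. *)
move: (Qle); rewrite le_eqVlt => /orP[/eqP QE|Qlt].
  rewrite -QE; split => // _.
  exists (optc M V), (Num.sqrt (optL M V)), b; split => //; first by rewrite sqrtr_gt0.
  apply: filterS (Qeq QE) => y ->.
  by rewrite bubbleE sqr_sqrtr// ltW.
have DD : N M V / D M (optQ M V) < N M V / D M Q.
  by rewrite ltr_pM2l// ltf_pV2 ?posrE ?D_gt0// ?optQ_gt0// D_mono.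
split; first by rewrite lee_fin ltW.
have neq (u v : R) : u < v -> v%:E = u%:E -> False.
  by rewrite -lte_fin => uv vu; rewrite vu ltxx in uv.
by move=> /(neq _ _ DD).
Qed.

(* Optimality follows without knowing that the barycenter of [f] is [x0]: the
   second moment about the barycenter is at most the one about [x0], so the
   comparison bubble has [L] and [c] at least those of [f], and its q-th power
   integral is at most that of [f]. *)
Lemma quotient_bubble (f : Rn R m -> R) (c l : R) (x0 : Rn R m) :
  measurable_fun setT f -> (forall y, 0 <= f y) -> 0 < c -> 0 < l ->
  {ae mu, forall x, f x = c * @bubble R m.+1 q (@translate_dilate R m.+1 l x0 x)} ->
  @admissible R m.+1 q f /\ @quotient R m.+1 (n + 2) q t f = sharp_value%:E.
Proof.
move=> mf f0 c0 l0 fae.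
pose L := l ^+ 2; have L0 : 0 < L by rewrite exprn_gt0.
pose w (y : Rn R m) := (1 + L * sqdist y x0) `^ (- sigma).
have {}fae : {ae mu, forall y, f y = c * w y}.
  by apply: filterS fae => y ->; rewrite bubbleE.
have w0 y : 0 <= w y by exact: powR_ge0.
have mw : measurable_fun setT w by exact: measurable_sqdist_powR.
have ms := @measurable_sqdist R m x0.
pose M := c * (L `^ (- (m%:R / 2)) * I).
have J0 : 0 < L `^ (- (m%:R / 2)) by rewrite powR_gt0.
have M0 : 0 < M by apply: mulr_gt0 => //; exact: mulr_gt0.
have fM : (\int[mu]_y (f y)%:E = M%:E)%E.
  transitivity (\int[mu]_y (c%:E * (w y)%:E))%E.
    apply: ge0_ae_eq_integral => //.
    - exact/measurable_EFinP.
    - by apply/measurable_EFinP; exact: measurable_funM.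
    - by move=> y _; rewrite lee_fin.
    - by move=> y _; rewrite lee_fin mulr_ge0// ltW.
    - by apply: filterS fae => y -> _; rewrite EFinM.
  rewrite ge0_integralZl//=.
  - by rewrite integral_profile.
  - exact/measurable_EFinP.
  - by move=> y _; rewrite lee_fin.
  - by rewrite lee_fin ltW.
pose Q := c `^ q * (L `^ (- (m%:R / 2)) * (rho * I)).
have Q0 : 0 < Q.
  by apply: mulr_gt0; [exact: powR_gt0|apply: mulr_gt0 => //; exact: mulr_gt0].
have fQ : (\int[mu]_y (f y `^ q)%:E = Q%:E)%E.
  transitivity (\int[mu]_y ((c `^ q)%:E * ((1 + L * sqdist y x0) `^ (- (sigma - 1)))%:E))%E.
    apply: ge0_ae_eq_integral => //.
    - by apply/measurable_EFinP; exact: (measurableT_comp (measurable_powR q)).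
    - by apply/measurable_EFinP; apply: measurable_funM => //; exact: measurable_sqdist_powR.
    - by move=> y _; rewrite lee_fin powR_ge0.
    - by move=> y _; rewrite lee_fin mulr_ge0// powR_ge0.
    - apply: filterS fae => y -> _; rewrite powRM ?(ltW c0)//.
      by rewrite /w profile_powR// EFinM.
  rewrite ge0_integralZl//=.
  - by rewrite integral_profile_powR.
  - by apply/measurable_EFinP; exact: measurable_sqdist_powR.
  - by move=> y _; rewrite lee_fin powR_ge0.
  - by rewrite lee_fin powR_ge0.
have adm : @admissible R m.+1 q f.
  by apply/(admissibleP _ q0); split => //; exists M, Q.
(* The shift [L^-1] makes the weight proportional to [1 + L|y-x0|^2], so the integral is a known one
   with exponent [sigma - 1]. It is also the extension at height [l^-1] above [x0], which is
   therefore finite. *)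
have fS : (\int[mu]_y ((sqdist y x0 + L^-1) * f y)%:E = (rho * M / L)%:E)%E.
  transitivity (\int[mu]_y ((c / L)%:E * ((1 + L * sqdist y x0) `^ (- (sigma - 1)))%:E))%E.
    apply: ge0_ae_eq_integral => //.
    - apply/measurable_EFinP; apply: measurable_funM => //; exact: measurable_funD.
    - by apply/measurable_EFinP; apply: measurable_funM => //; exact: measurable_sqdist_powR.
    - by move=> y _; rewrite lee_fin mulr_ge0// addr_ge0 ?sqdist_ge0// invr_ge0 ltW.
    - by move=> y _; rewrite lee_fin mulr_ge0 ?powR_ge0// divr_ge0// ltW.
    - apply: filterS fae => y -> _; rewrite -EFinM; congr EFin.
      have pos : 0 < 1 + L * sqdist y x0 by rewrite ltr_wpDr// mulr_ge0 ?sqdist_ge0// ltW.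
      rewrite opprB addrC gt0_powRD// powRr1 ?(ltW pos)// -/(w y).
      by field; rewrite gt_eqF.
  rewrite ge0_integralZl//=.
  - by rewrite integral_profile_powR// -EFinM; congr EFin; rewrite /M; ring.
  - by apply/measurable_EFinP; exact: measurable_sqdist_powR.
  - by move=> y _; rewrite lee_fin powR_ge0.
  - by rewrite lee_fin divr_ge0// ltW.
have fx : (@extension R m.+1 (n + 2) f (x0, l^-1%R) < +oo)%E.
  by rewrite extensionE /= exprVn fS ltry.
have [b [V [V0 bV fV]]] := extension_quadratic m0 mf f0 fM M0 fx.
split => //; rewrite (quotient_fin f0 M0 Q0 V0 fM fQ fV) -(quotient_opt M0 V0).
have [oL0 oc0] := optimal_gt0 M0 V0.
have [Qle _] := powR_integral_le q01 qm oc0 oL0 mf f0 fM bV fQ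
  (mass_opt M0 V0) (moment_opt M V0).
suff : optQ M V <= Q.
  by move=> Qge; congr (_ / D _ _)%:E; apply/eqP; rewrite eq_le Qle.
(* The moment about [x0] is [V + M |x0 - b|^2 = S M / L], so [V <= S M / L]. *)
have VL : L <= optL M V.
  rewrite ler_pdivlMr// mulrC -ler_pdivlMr//.
  have : V + M * (sqdist x0 b + L^-1) = rho * M / L.
    by apply: EFin_inj; rewrite -fS fV.
  have -> : rho * M / L = S * M / L + M * L^-1 by rewrite rhoS; ring.
  have := mulr_ge0 (ltW M0) (sqdist_ge0 x0 b).
  by rewrite mulrDr; lra.
have cc : c <= optc M V.
  have -> : c = M * L `^ (m%:R / 2) / I.
    rewrite /M powRN; field.
    by rewrite !gt_eqF// powR_gt0.
  rewrite /optc ler_pM2r ?invr_gt0// ler_pM2l//.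
  by apply: ge0_ler_powR => //; rewrite ?nnegrE; apply: ltW => //; rewrite divr_gt0.
(* For bubbles of the same mass [M] the power integral is [c'^(q-1) rho M], which decreases in [c']
   because [q < 1]. *)
have QE c' L' : 0 < c' -> c' `^ q * (L' `^ (- (m%:R / 2)) * (rho * I)) =
    c' `^ (q - 1) * (rho * (c' * (L' `^ (- (m%:R / 2)) * I))).
  move=> c'0; have -> : c' `^ q = c' `^ (q - 1) * c'.
    by rewrite -{3}(powRr1 (ltW c'0)) -gt0_powRD// subrK.
  by ring.
rewrite /optQ /Q !QE// -mass_opt// -/M ler_pM2r; last exact: mulr_gt0.
by apply: npos_ler_powR => //; rewrite subr_le0 ltW.
Qed.

Lemma sharp_constE : @sharp_const R m.+1 (n + 2) q t = sharp_value%:E.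
Proof.
pose f := @bubble R m.+1 q.
have mf : measurable_fun setT f.
  rewrite (_ : f = fun y => (1 + 1 * sqdist y [tuple 0 | i < m]) `^ (- sigma)).
    exact: measurable_sqdist_powR.
  apply/funext => y; rewrite /f /bubble mul1r; congr ((1 + _) `^ _).
  by apply: eq_bigr => i _; rewrite tnth_mktuple subr0.
have [adm fq] : @admissible R m.+1 q f /\ @quotient R m.+1 (n + 2) q t f = sharp_value%:E.
  apply: (@quotient_bubble f 1 1 [tuple 0 | i < m]) => //.
    by move=> y; exact: powR_ge0.
  apply: aeW => y; rewrite mul1r; congr (bubble _ _).
  by apply: eq_from_tnth => i; rewrite !tnth_mktuple subr0 mul1r.
apply/eqP; rewrite eq_le; apply/andP; split.
  by rewrite -fq; apply: ereal_inf_lbound; exists f.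
by apply: le_ereal_inf_tmp => _ [g gadm <-]; exact: (quotient_ge gadm).1.
Qed.

Lemma extremalP (f : Rn R m -> R) : measurable_fun setT f -> (forall y, 0 <= f y) ->
  @extremal R m.+1 (n + 2) q t f <->
  exists (c l : R) (x0 : Rn R m), [/\ 0 < c, 0 < l &
    {ae mu, forall x, f x = c * @bubble R m.+1 q (@translate_dilate R m.+1 l x0 x)}].
Proof.
move=> mf f0; rewrite /extremal sharp_constE; split.
  by move=> [adm fq]; exact: (quotient_ge adm).2.
by move=> [c [l [x0 [c0 l0 fae]]]]; exact: quotient_bubble fae.
Qed.

Lemma sharp_inequality f : @admissible R m.+1 q f ->
  (@sharp_const R m.+1 (n + 2) q t * @rhs_norms R m.+1 (n + 2) q t f <=
   @norm_half_space R m.+1 t' (@extension R m.+1 (n + 2) f))%E.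
Proof.
move=> adm; have := (quotient_ge adm).1; rewrite sharp_constE.
have /(admissibleP _ q0)[mf f0 [M [Q [M0 Q0 fM fQ]]]] := adm.
rewrite /quotient tt' (rhs_normsE f0 M0 Q0 fM fQ) inver gt_eqF ?D_gt0//.
by rewrite lee_pdivlMr ?D_gt0.
Qed.

End main.

Theorem corollary3p3 (R : realType) (n : nat) (alpha t q t' : R) :
  (2 <= n)%N -> alpha = n%:R + 2 ->
  n%:R / (n%:R + 2) < t -> t < 1 ->
  (n%:R - 1) / (n%:R + 1) < q -> q < 1 ->
  t^-1 + t'^-1 = 1 ->
  [/\ forall f : Rn R n.-1 -> R, admissible q f ->
        (sharp_const n alpha q t * rhs_norms alpha q t f <=
         norm_half_space t' (extension alpha f))%E,
      forall f : Rn R n.-1 -> R,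
        measurable_fun setT f -> (forall x, 0 <= f x) ->
        (extremal alpha q t f <->
         exists (c l : R) (x0 : Rn R n.-1),
           [/\ 0 < c, 0 < l &
               {ae lebesgue_Rn R n.-1, forall x,
                  f x = c * bubble q (translate_dilate l x0 x)}]) &
      sharp_const n alpha q t =
      (pi^-1 *
       (((q * (n%:R + 1) - n%:R + 1) / (2 * q))
          `^ ((n%:R + 2 * t') / ((n%:R - 1) * (1 - q))) *
        (((n%:R - 1) * (1 - q)) / (q * (n%:R + 1) - n%:R + 1))
          `^ (n%:R / 2 + t') *
        (Gamma (1 - q)^-1 / Gamma ((1 - q)^-1 - (n%:R - 1) / 2))
          `^ ((n%:R + 2 * t') / (n%:R - 1)) *
        (Gamma (- t' - n%:R / 2) / (2 * Gamma (- t'))))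
       `^ t'^-1)%:E].
Proof.
case: n => [//|m]; rewrite ltnS => m0 -> nt t1 nq q1 ett'.
have n0 : 0 < m.+1%:R :> R by rewrite ltr0n.
have n1 : 1 <= m.+1%:R :> R by rewrite ler1n.
have t0 : 0 < t by apply: lt_trans nt; rewrite divr_gt0// addr_gt0.
have q0 : 0 < q.
  by apply: le_lt_trans nq; rewrite divr_ge0 ?subr_ge0// addr_ge0// ltW.
have t'E : t'^-1 = 1 - t^-1 by rewrite -ett' addrAC subrr add0r.
have tt' : conj_exponent t = t' by rewrite /conj_exponent -t'E invrK.
have s0 : 0 < - t'^-1 by rewrite t'E opprB subr_gt0 invf_gt1.
(* From [- t'^-1 = t^-1 - 1], the claim amounts to [t^-1 < 1 + 2 / n = (n + 2) / n], the lower bound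
   on [t]. *)
have t'n : m.+1%:R / 2 < - t'.
  have -> : - t' = (- t'^-1)^-1 by rewrite invrN invrK.
  rewrite -[ltLHS]invrK ltf_pV2 ?posrE ?invr_gt0 ?divr_gt0// t'E opprB invf_div.
  rewrite ltrBlDr -[ltRHS]invrK ltf_pV2 ?posrE ?invr_gt0 ?addr_gt0 ?divr_gt0//.
  by congr (_ < t): nt; field; rewrite !gt_eqF// addr_gt0.
split.
- exact: sharp_inequality.
- move=> f mf f0; exact: (extremalP m0 tt' t'n q0 q1 nq mf f0).
- exact: sharp_constE.
Qed.
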